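(* Let $k$ be an infinite field of any characteristic and let $A$ and $B$ be two étale $k$-algebras of finite dimension. Assume that $\dim_k(A)$ and $\dim_k(B)$ are coprime. Then $Q(A,B)$ is $k$-rational.
   Context: A variety $X$ over $k$ is said to be $k$-rational if it is birational (over $k$) to a projective space $\mathbb{P}^n_k$. A finite-dimensional commutative $k$-algebra $A$ is étale if $A\cong\prod_{i=1}^n k_i$ with each $k_i$ a finite separable field extension of $k$; equivalently, $A\otimes_k\overline{k}$ is isomorphic, as a $\overline{k}$-algebra, to a finite product of copies of $\overline{k}$, where $\overline{k}$ is an algebraic closure of $k$. For a finite-dimensional unital $k$-algebra $A$, $\mathrm{GL}_1(A)$ denotes the linear algebraic group over $k$ representing the functor $X\mapsto (A\otimes_k\Gamma(X,\mathcal{O}_X))^\times$ from $k$-schemes to groups. For $A$ commutative it is canonically isomorphic to the Weil restriction $\mathrm{Res}_{A/k}(\mathbb{G}_m)$. For finite-dimensional commutative $k$-algebras $A$ and $B$ there is an exact sequence of algebraic groups $$1\to\mathbb{G}_m\xrightarrow{\ i\ }\mathrm{GL}_1(A)\times\mathrm{GL}_1(B)\xrightarrow{\ j\ }\mathrm{GL}_1(A\otimes_k B),\qquad i(x)=(x,x^{-1}),\quad j(a,b)=a\otimes b.$$ Put $H(A,B)=\mathrm{im}(j)$ and define the quotient algebraic group $$Q(A,B):=\mathrm{GL}_1(A\otimes_k B)/H(A,B).$$ *)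

(* Defs.v *)
From HB Require Import structures.
From mathcomp Require Import all_boot all_order all_fingroup all_algebra all_field.
From mathcomp Require Import boolp.

Set Implicit Arguments.
Unset Strict Implicit.
Unset Printing Implicit Defensive.

Import GRing.Theory.
Local Open Scope ring_scope.

(* The phi i are the components of the isomorphism from A to the product of
   the finite separable field extensions K i. *)
Definition etale (k : fieldType) (A : falgType k) : Prop :=
  exists (n : nat) (K : 'I_n -> fieldExtType k)
         (phi : forall i, {lrmorphism A -> K i}),
    [/\ forall i, separable 1%VS {: K i},
        forall x y : A, (forall i, phi i x = phi i y) -> x = y
      & forall z : (forall i, K i), exists x : A, forall i, phi i x = z i].

(* The tensor product of k-algebras A and R, with A finite-dimensional: A is
   free on the basis e = vbasis {:A}, so each element is the sum of the
   tens (e i) (x i) for a unique family x, which is used to represent it. *)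
Definition tensor (k : fieldType) (A : falgType k) (R : Type) : Type :=
  {ffun 'I_(\dim {: A}) -> R}.

Section TensorAlgebra.
Variables (k : fieldType) (A : falgType k) (R : algType k).

HB.instance Definition _ :=
  GRing.Lmodule.copy (tensor A R) {ffun 'I_(\dim {: A}) -> R}.

Local Notation T := (tensor A R).
Local Notation e := (vbasis {: A}).
Implicit Types (a b : A) (r s : R) (x y z : T).

Definition tens a r : T := [ffun i => coord e i a *: r].

Definition tensor_one : T := tens 1 1.

Definition tensor_mul x y : T :=
  \sum_(i < \dim {: A}) \sum_(j < \dim {: A}) tens (e`_i * e`_j) (x i * y j).

Lemma tens_suml I (t : seq I) (P : pred I) (F : I -> A) r :
  tens (\sum_(i <- t | P i) F i) r = \sum_(i <- t | P i) tens (F i) r.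
Proof.
apply/ffunP=> l; rewrite !ffunE linear_sum scaler_suml sum_ffunE.
by apply: eq_bigr => i _; rewrite ffunE.
Qed.

Lemma tens_sumr I (t : seq I) (P : pred I) (F : I -> R) a :
  tens a (\sum_(i <- t | P i) F i) = \sum_(i <- t | P i) tens a (F i).
Proof.
apply/ffunP=> l; rewrite !ffunE scaler_sumr sum_ffunE.
by apply: eq_bigr => i _; rewrite ffunE.
Qed.

Lemma tensDr a r s : tens a (r + s) = tens a r + tens a s.
Proof. by apply/ffunP=> l; rewrite !ffunE scalerDr. Qed.

Lemma tensZl c a r : tens (c *: a) r = c *: tens a r.
Proof. by apply/ffunP=> l; rewrite !ffunE linearZ /= scalerA. Qed.

Lemma tensZr c a r : tens a (c *: r) = c *: tens a r.
Proof. by apply/ffunP=> l; rewrite !ffunE !scalerA mulrC. Qed.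

Lemma tens_expand x : x = \sum_(i < \dim {: A}) tens e`_i (x i).
Proof.
apply/ffunP=> l; rewrite sum_ffunE (bigD1 l) //= ffunE.
rewrite coord_free ?(basis_free (vbasisP _)) // eqxx scale1r big1 ?addr0 //.
move=> i nil; rewrite ffunE coord_free ?(basis_free (vbasisP _)) //.
by rewrite (negbTE nil) scale0r.
Qed.

Lemma basis_expand a : a = \sum_(i < \dim {: A}) coord e i a *: e`_i.
Proof. by apply: coord_vbasis; rewrite memvf. Qed.

Lemma tensor_ind (P : T -> Prop) :
    (forall a r, P (tens a r)) -> (forall x y, P x -> P y -> P (x + y)) ->
  forall x, P x.
Proof.
move=> Pt PD x; rewrite (tens_expand x); apply: big_ind => //.
suff -> : 0 = tens 0 0 by exact: Pt.
by apply/ffunP=> l; rewrite !ffunE scaler0.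
Qed.

Lemma tensor_mulDl : left_distributive tensor_mul +%R.
Proof.
move=> x y z; rewrite /tensor_mul -big_split; apply: eq_bigr => i _ /=.
rewrite -big_split; apply: eq_bigr => j _ /=.
by rewrite ffunE mulrDl tensDr.
Qed.

Lemma tensor_mulDr : right_distributive tensor_mul +%R.
Proof.
move=> x y z; rewrite /tensor_mul -big_split; apply: eq_bigr => i _ /=.
rewrite -big_split; apply: eq_bigr => j _ /=.
by rewrite ffunE mulrDr tensDr.
Qed.

Lemma tensor_mul_tens a b r s :
  tensor_mul (tens a r) (tens b s) = tens (a * b) (r * s).
Proof.
rewrite {2}(basis_expand a) {2}(basis_expand b) mulr_suml tens_suml.
apply: eq_bigr => i _; rewrite mulr_sumr tens_suml; apply: eq_bigr => j _.
rewrite !ffunE -[in LHS]scalerAl -[in LHS]scalerAr -[in RHS]scalerAl.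
by rewrite -[in RHS]scalerAr !tensZl !tensZr.
Qed.

Lemma tensor_mulA : associative tensor_mul.
Proof.
move=> x y z; elim/tensor_ind: x => [a r|x x' IH IH'] in y z *; last first.
  by rewrite !tensor_mulDl IH IH'.
elim/tensor_ind: y => [b s|y y' IH IH'] in z *; last first.
  by rewrite tensor_mulDl !tensor_mulDr tensor_mulDl IH IH'.
elim/tensor_ind: z => [c t|z z' IH IH']; last first.
  by rewrite !tensor_mulDr IH IH'.
by rewrite !tensor_mul_tens !mulrA.
Qed.

Lemma tensor_mul1l : left_id tensor_one tensor_mul.
Proof.
move=> x; elim/tensor_ind: x => [a r|x x' IH IH']; last by rewrite tensor_mulDr IH IH'.
by rewrite tensor_mul_tens !mul1r.
Qed.

Lemma tensor_mul1r : right_id tensor_one tensor_mul.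
Proof.
move=> x; elim/tensor_ind: x => [a r|x x' IH IH']; last by rewrite tensor_mulDl IH IH'.
by rewrite tensor_mul_tens !mulr1.
Qed.

Lemma tensor_one_neq0 : tensor_one != 0.
Proof.
apply/eqP=> T0; suff: (1 : A) = 0 by apply/eqP; exact: oner_neq0.
rewrite (basis_expand 1) big1 // => i _.
move/ffunP: T0 => /(_ i); rewrite !ffunE => /(congr1 (fun v => v == 0)).
by rewrite scaler_eq0 oner_eq0 orbF eqxx => /eqP ->; rewrite scale0r.
Qed.

HB.instance Definition _ := GRing.Zmodule_isNzRing.Build T
  tensor_mulA tensor_mul1l tensor_mul1r tensor_mulDl tensor_mulDr
  tensor_one_neq0.

Lemma tens_mul a b r s : tens a r * tens b s = tens (a * b) (r * s).
Proof. exact: tensor_mul_tens. Qed.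

Lemma tensor_scaleAl (c : k) x y : c *: (x * y) = (c *: x) * y.
Proof.
elim/tensor_ind: x => [a r|x x' IH IH']; last first.
  by rewrite mulrDl !scalerDr mulrDl IH IH'.
elim/tensor_ind: y => [b s|y y' IH IH']; last first.
  by rewrite !mulrDr scalerDr IH IH'.
by rewrite -!tensZl !tens_mul -tensZl scalerAl.
Qed.

HB.instance Definition _ := GRing.Lmodule_isLalgebra.Build k T tensor_scaleAl.

Lemma tensor_scaleAr (c : k) x y : c *: (x * y) = x * (c *: y).
Proof.
elim/tensor_ind: x => [a r|x x' IH IH']; last first.
  by rewrite !mulrDl scalerDr IH IH'.
elim/tensor_ind: y => [b s|y y' IH IH']; last first.
  by rewrite mulrDr !scalerDr mulrDr IH IH'.
by rewrite -!tensZl !tens_mul -tensZl scalerAr.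
Qed.

HB.instance Definition _ := GRing.Lalgebra_isAlgebra.Build k T tensor_scaleAr.

End TensorAlgebra.

HB.instance Definition _ (k : fieldType) (A B : falgType k) :=
  Vector.copy (tensor A B) {ffun 'I_(\dim {: A}) -> B}.
HB.instance Definition _ (k : fieldType) (A B : falgType k) :=
  Algebra_isFalgebra.Build k (tensor A B).


Section BaseChange.
Variables (k : fieldType) (A : falgType k) (R S T : algType k).

Definition tensor_map (f : {lrmorphism R -> S}) (x : tensor A R) : tensor A S :=
  [ffun i => f (x i)].

Lemma tensor_map_tens (f : {lrmorphism R -> S}) a r :
  tensor_map f (tens a r) = tens a (f r).
Proof. by apply/ffunP=> i; rewrite !ffunE linearZ. Qed.

Lemma tensor_mapD (f : {lrmorphism R -> S}) x y :
  tensor_map f (x + y) = tensor_map f x + tensor_map f y.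
Proof. by apply/ffunP=> i; rewrite !ffunE rmorphD. Qed.

Lemma tensor_map1 (f : {lrmorphism R -> S}) : tensor_map f 1 = 1.
Proof. by rewrite [LHS]tensor_map_tens rmorph1. Qed.

Lemma tensor_mapM (f : {lrmorphism R -> S}) x y :
  tensor_map f (x * y) = tensor_map f x * tensor_map f y.
Proof.
elim/tensor_ind: x => [a r|x x' IH IH']; last first.
  by rewrite mulrDl !tensor_mapD mulrDl IH IH'.
elim/tensor_ind: y => [b s|y y' IH IH']; last first.
  by rewrite mulrDr !tensor_mapD mulrDr IH IH'.
by rewrite tens_mul !tensor_map_tens tens_mul rmorphM.
Qed.

End BaseChange.

(* The R-bilinear pairing (A (x) R) x (B (x) R) -> (A (x) B) (x) R. *)
Section ExternalProduct.
Variables (k : fieldType) (A B : falgType k) (R : comAlgType k).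
Local Notation e := (vbasis {: A}).
Local Notation f := (vbasis {: B}).

Definition tensor_ext (x : tensor A R) (y : tensor B R) :
    tensor (tensor A B) R :=
  \sum_(i < \dim {: A}) \sum_(j < \dim {: B})
    tens (tens e`_i f`_j) (x i * y j).

Lemma tensor_extDl x x' y :
  tensor_ext (x + x') y = tensor_ext x y + tensor_ext x' y.
Proof.
rewrite /tensor_ext -big_split; apply: eq_bigr => i _ /=.
rewrite -big_split; apply: eq_bigr => j _ /=.
by rewrite ffunE mulrDl tensDr.
Qed.

Lemma tensor_extDr x y y' :
  tensor_ext x (y + y') = tensor_ext x y + tensor_ext x y'.
Proof.
rewrite /tensor_ext -big_split; apply: eq_bigr => i _ /=.
rewrite -big_split; apply: eq_bigr => j _ /=.
by rewrite ffunE mulrDr tensDr.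
Qed.

Lemma tensor_ext_tens a b r s :
  tensor_ext (tens a r) (tens b s) = tens (tens a b) (r * s).
Proof.
rewrite {2}(basis_expand a) {2}(basis_expand b) tens_suml tens_suml.
apply: eq_bigr => i _; rewrite tens_sumr tens_suml; apply: eq_bigr => j _.
rewrite !ffunE -scalerAl -scalerAr !tensZr !tensZl.
by rewrite scalerA mulrC -scalerA.
Qed.

Lemma tensor_extM x x' y y' :
  tensor_ext x y * tensor_ext x' y' = tensor_ext (x * x') (y * y').
Proof.
elim/tensor_ind: x => [a r|x1 x2 IH1 IH2] in x' y y' *; last first.
  by rewrite tensor_extDl !mulrDl tensor_extDl IH1 IH2.
elim/tensor_ind: x' => [a' r'|x1 x2 IH1 IH2] in y y' *; last first.
  by rewrite tensor_extDl !mulrDr tensor_extDl IH1 IH2.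
elim/tensor_ind: y => [b s|x1 x2 IH1 IH2] in y' *; last first.
  by rewrite tensor_extDr !mulrDl tensor_extDr IH1 IH2.
elim/tensor_ind: y' => [b' s'|x1 x2 IH1 IH2]; last first.
  by rewrite tensor_extDr !mulrDr tensor_extDr IH1 IH2.
by rewrite !tens_mul !tensor_ext_tens !tens_mul mulrACA.
Qed.

Lemma tensor_ext1 : tensor_ext 1 1 = 1.
Proof. by rewrite [LHS]tensor_ext_tens mulr1. Qed.

End ExternalProduct.

Lemma tensor_ext_map (k : fieldType) (A B : falgType k) (R S : comAlgType k)
    (f : {lrmorphism R -> S}) (x : tensor A R) (y : tensor B R) :
  tensor_map f (tensor_ext x y) =
  tensor_ext (tensor_map f x) (tensor_map f y).
Proof.
elim/tensor_ind: x => [a r|x x' IH IH']; last first.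
  by rewrite tensor_mapD !tensor_extDl tensor_mapD IH IH'.
elim/tensor_ind: y => [b s|y y' IH IH']; last first.
  by rewrite tensor_mapD !tensor_extDr tensor_mapD IH IH'.
by rewrite !tensor_map_tens !tensor_ext_tens tensor_map_tens rmorphM.
Qed.

Section UnitGroup.
Variables (k : fieldType) (T : algType k).

Definition units : Type :=
  {p : T * T | (p.1 * p.2 == 1) && (p.2 * p.1 == 1)}.

HB.instance Definition _ := Choice.on units.

Implicit Types u v w : units.

Definition uval u : T := (val u).1.
Definition uinv u : T := (val u).2.

Lemma uvalV u : uval u * uinv u = 1.
Proof. by case/andP: (valP u) => /eqP. Qed.

Lemma uinvK u : uinv u * uval u = 1.
Proof. by case/andP: (valP u) => _ /eqP. Qed.

Definition unit_of (x y : T) (xy : x * y = 1) (yx : y * x = 1) : units :=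
  exist _ (x, y) (introT andP (conj (introT eqP xy) (introT eqP yx))).

Lemma units_inj u v : uval u = uval v -> u = v.
Proof.
move=> uv; apply: val_inj.
rewrite [val u]surjective_pairing [val v]surjective_pairing.
congr (_, _); first exact: uv.
suff: uinv u = uinv v by [].
by rewrite -[LHS]mul1r -(uinvK v) -mulrA -uv uvalV mulr1.
Qed.

Definition units_one : units := unit_of (mulr1 1) (mulr1 1).

Definition units_inv u : units := unit_of (uinvK u) (uvalV u).

Fact units_mul_subproof u v : (uval u * uval v) * (uinv v * uinv u) = 1.
Proof. by rewrite -mulrA (mulrA (uval v)) uvalV mul1r uvalV. Qed.

Fact units_mul_subproofV u v : (uinv v * uinv u) * (uval u * uval v) = 1.
Proof. by rewrite -mulrA (mulrA (uinv u)) uinvK mul1r uinvK. Qed.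

Definition units_mul u v : units :=
  unit_of (units_mul_subproof u v) (units_mul_subproofV u v).

Fact units_mulA : associative units_mul.
Proof. by move=> u v w; apply: units_inj; exact: mulrA. Qed.
Fact units_mul1l : left_id units_one units_mul.
Proof. by move=> u; apply: units_inj; exact: mul1r. Qed.
Fact units_mul1r : right_id units_one units_mul.
Proof. by move=> u; apply: units_inj; exact: mulr1. Qed.
Fact units_mulV : left_inverse units_one units_inv units_mul.
Proof. by move=> u; apply: units_inj; exact: uinvK. Qed.
Fact units_mulrV : right_inverse units_one units_inv units_mul.
Proof. by move=> u; apply: units_inj; exact: uvalV. Qed.

HB.instance Definition _ := isGroup.Build units
  units_mulA units_mul1l units_mul1r units_mulV units_mulrV.

End UnitGroup.

(* Schemes over k are given by their functors of points on commutative
   k-algebras.  The zero algebra is not a comAlgType; it may be left out since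
   a scheme has exactly one point over it. *)
Record kfunctor (k : fieldType) := KFunctor {
  pts :> comAlgType k -> Type;
  fmap : forall R S : comAlgType k, {lrmorphism R -> S} -> pts R -> pts S;
  fmap_id : forall (R : comAlgType k) (x : pts R),
    fmap (idfun : {lrmorphism R -> R}) x = x;
  fmap_comp : forall (R S T : comAlgType k) (f : {lrmorphism R -> S})
    (g : {lrmorphism S -> T}) (x : pts R),
    fmap (g \o f : {lrmorphism R -> T}) x = fmap g (fmap f x)
}.
Arguments fmap {k} k0 {R S} f x : rename.

Record kgroup (k : fieldType) := KGroup {
  gpts : comAlgType k -> groupType;
  gmap : forall R S : comAlgType k, {lrmorphism R -> S} -> gpts R -> gpts S;
  gmap_id : forall (R : comAlgType k) (x : gpts R),
    gmap (idfun : {lrmorphism R -> R}) x = x;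
  gmap_comp : forall (R S T : comAlgType k) (f : {lrmorphism R -> S})
    (g : {lrmorphism S -> T}) (x : gpts R),
    gmap (g \o f : {lrmorphism R -> T}) x = gmap g (gmap f x);
  gmapM : forall (R S : comAlgType k) (f : {lrmorphism R -> S}) (x y : gpts R),
    gmap f (x * y)%g = (gmap f x * gmap f y)%g
}.

Coercion kgroup_functor (k : fieldType) (G : kgroup k) : kfunctor k :=
  KFunctor (@gmap_id k G) (@gmap_comp k G).

Record kmap (k : fieldType) (X Y : kfunctor k) := KMap {
  kmap_fun :> forall R : comAlgType k, X R -> Y R;
  kmap_nat : forall (R S : comAlgType k) (f : {lrmorphism R -> S}) (x : X R),
    kmap_fun (fmap X f x) = fmap Y f (kmap_fun x)
}.

Definition kisomorphic (k : fieldType) (X Y : kfunctor k) : Prop :=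
  exists f : kmap X Y, forall R : comAlgType k, bijective (f R).

Section AffineSpace.
Variables (k : fieldType) (n : nat).

Fact affine_space_id (R : comAlgType k) (x : 'rV[R]_n) :
  map_mx (idfun : {lrmorphism R -> R}) x = x.
Proof. by apply/matrixP=> i j; rewrite mxE. Qed.

Fact affine_space_comp (R S T : comAlgType k) (f : {lrmorphism R -> S})
    (g : {lrmorphism S -> T}) (x : 'rV[R]_n) :
  map_mx (g \o f : {lrmorphism R -> T}) x = map_mx g (map_mx f x).
Proof. by apply/matrixP=> i j; rewrite !mxE. Qed.

Definition affine_space : kfunctor k :=
  @KFunctor k (fun R => 'rV[R]_n) (fun R S f x => map_mx f x)
    affine_space_id affine_space_comp.

End AffineSpace.

Section Product.
Variables (k : fieldType) (X Y : kfunctor k).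

Definition kprod_map (R S : comAlgType k) (f : {lrmorphism R -> S})
    (p : X R * Y R) : X S * Y S :=
  (fmap X f p.1, fmap Y f p.2).

Fact kprod_id (R : comAlgType k) (p : X R * Y R) :
  kprod_map (idfun : {lrmorphism R -> R}) p = p.
Proof. by case: p => x y; rewrite /kprod_map !fmap_id. Qed.

Fact kprod_comp (R S T : comAlgType k) (f : {lrmorphism R -> S})
    (g : {lrmorphism S -> T}) (p : X R * Y R) :
  kprod_map (g \o f : {lrmorphism R -> T}) p = kprod_map g (kprod_map f p).
Proof. by rewrite /kprod_map !fmap_comp. Qed.

Definition kprod : kfunctor k := KFunctor kprod_id kprod_comp.

End Product.

Section RegularFunctions.
Variables (k : fieldType) (X : kfunctor k).

(* The elements of the coordinate ring k[X], as maps from X to the affine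
   line.  They quantify over all k-algebras, so for universe reasons they
   cannot themselves form a comAlgType k. *)
Record regfun := RegFun {
  rf_fun :> forall R : comAlgType k, X R -> R;
  rf_nat : forall (R S : comAlgType k) (f : {lrmorphism R -> S}) (x : X R),
    rf_fun (fmap X f x) = f (rf_fun x)
}.

Definition non_zero_divisor (f : regfun) : Prop :=
  forall g : regfun, (forall (R : comAlgType k) (x : X R), f R x * g R x = 0) ->
  forall (R : comAlgType k) (x : X R), g R x = 0.

(* Both components of a point (x, t) of the principal open D(f) are kept: t
   is the inverse of f x, hence determined by x. *)
Definition principal_open_pts (f : regfun) (R : comAlgType k) : Type :=
  {p : X R * R | f R p.1 * p.2 == 1}.

Variable f : regfun.

Fact principal_open_subproof (R S : comAlgType k) (h : {lrmorphism R -> S})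
    (p : principal_open_pts f R) :
  f S (fmap X h (sval p).1) * h (sval p).2 == 1.
Proof. by rewrite rf_nat -rmorphM (eqP (svalP p)) rmorph1. Qed.

Definition principal_open_map (R S : comAlgType k) (h : {lrmorphism R -> S})
    (p : principal_open_pts f R) : principal_open_pts f S :=
  exist _ (fmap X h (sval p).1, h (sval p).2) (principal_open_subproof h p).

Fact principal_open_inj (R : comAlgType k) (p q : principal_open_pts f R) :
  sval p = sval q -> p = q.
Proof.
by case: p q => [p pP] [q qP] /= pq; subst q; congr exist; exact: bool_irrelevance.
Qed.

Fact principal_open_id (R : comAlgType k) (p : principal_open_pts f R) :
  principal_open_map (idfun : {lrmorphism R -> R}) p = p.
Proof.
by apply: principal_open_inj => /=; rewrite fmap_id; case: (sval p).
Qed.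

Fact principal_open_comp (R S T : comAlgType k) (h : {lrmorphism R -> S})
    (h' : {lrmorphism S -> T}) (p : principal_open_pts f R) :
  principal_open_map (h' \o h : {lrmorphism R -> T}) p =
  principal_open_map h' (principal_open_map h p).
Proof. by apply: principal_open_inj; rewrite /= fmap_comp. Qed.

Definition principal_open : kfunctor k :=
  KFunctor principal_open_id principal_open_comp.

End RegularFunctions.

(* For affine X and Y.  Every dense open subset of an integral affine scheme
   contains a nonempty principal one, and D(f) is (schematically) dense exactly
   when f is not a zero divisor, so this says that X and Y have isomorphic
   dense open subschemes. *)
Definition birational (k : fieldType) (X Y : kfunctor k) : Prop :=
  exists (f : regfun X) (g : regfun Y),
    [/\ non_zero_divisor f, non_zero_divisor g
      & kisomorphic (principal_open f) (principal_open g)].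

(* Affine n-space stands for projective n-space, of which it is a dense
   open subscheme. *)
Definition k_rational (k : fieldType) (X : kfunctor k) : Prop :=
  exists n : nat, birational X (affine_space k n).

(* The R-points of the closed image of j, the closed subscheme of Y defined by
   the kernel of k[Y] -> k[X].  When j is a homomorphism of affine algebraic
   groups this is the image of j as an algebraic group. *)
Definition image_pts (k : fieldType) (X Y : kfunctor k) (j : kmap X Y)
    (R : comAlgType k) (y : Y R) : Prop :=
  forall f : regfun Y,
    (forall (S : comAlgType k) (x : X S), f S (j S x) = 0) -> f R y = 0.

Section Quotient.
Variables (k : fieldType) (G : kgroup k).
Variable H : forall R : comAlgType k, G R -> Prop.

(* The elements of k[G]^H, for H acting on G by translations. *)
Record invfun := InvFun {
  inv_fun :> regfun G;
  invP : forall (R : comAlgType k) (g h : gpts G R),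
    H h -> inv_fun R (g * h)%g = inv_fun R g
}.

Implicit Types u v : invfun.

Fact inv_const_nat (c : k) (R S : comAlgType k) (f : {lrmorphism R -> S})
    (x : G R) : c%:A = f c%:A.
Proof. by rewrite linearZ rmorph1. Qed.

Fact inv_const_inv (c : k) (R : comAlgType k) (g h : gpts G R) :
  H h -> c%:A = c%:A :> R.
Proof. by []. Qed.

Definition inv_const (c : k) : invfun :=
  @InvFun (RegFun (inv_const_nat c)) (inv_const_inv c).

Fact inv_add_nat u v (R S : comAlgType k) (f : {lrmorphism R -> S}) (x : G R) :
  u S (fmap G f x) + v S (fmap G f x) = f (u R x + v R x).
Proof. by rewrite !rf_nat rmorphD. Qed.

Fact inv_add_inv u v (R : comAlgType k) (g h : gpts G R) :
  H h -> u R (g * h)%g + v R (g * h)%g = u R g + v R g.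
Proof. by move=> Hh; rewrite !invP. Qed.

Definition inv_add u v : invfun :=
  @InvFun (RegFun (inv_add_nat u v)) (inv_add_inv u v).

Fact inv_mul_nat u v (R S : comAlgType k) (f : {lrmorphism R -> S}) (x : G R) :
  u S (fmap G f x) * v S (fmap G f x) = f (u R x * v R x).
Proof. by rewrite !rf_nat rmorphM. Qed.

Fact inv_mul_inv u v (R : comAlgType k) (g h : gpts G R) :
  H h -> u R (g * h)%g * v R (g * h)%g = u R g * v R g.
Proof. by move=> Hh; rewrite !invP. Qed.

Definition inv_mul u v : invfun :=
  @InvFun (RegFun (inv_mul_nat u v)) (inv_mul_inv u v).

(* The quotient of an affine algebraic group G by a closed normal subgroup H is
   affine with coordinate ring k[G]^H, that is, G / H = Spec k[G]^H: its
   R-points are the homomorphisms of k-algebras from k[G]^H to R. *)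
Record quotient_pts (R : comAlgType k) := QuotientPt {
  qev :> invfun -> R;
  qevC : forall c : k, qev (inv_const c) = c%:A;
  qevD : forall u v : invfun, qev (inv_add u v) = qev u + qev v;
  qevM : forall u v : invfun, qev (inv_mul u v) = qev u * qev v
}.

Section QuotientMap.
Variables (R S : comAlgType k) (f : {lrmorphism R -> S}) (x : quotient_pts R).

Fact quotient_mapC (c : k) : f (x (inv_const c)) = c%:A.
Proof. by rewrite qevC linearZ rmorph1. Qed.

Fact quotient_mapD u v : f (x (inv_add u v)) = f (x u) + f (x v).
Proof. by rewrite qevD rmorphD. Qed.

Fact quotient_mapM u v : f (x (inv_mul u v)) = f (x u) * f (x v).
Proof. by rewrite qevM rmorphM. Qed.

Definition quotient_map : quotient_pts S :=
  @QuotientPt S (fun u => f (x u)) quotient_mapC quotient_mapD quotient_mapM.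

End QuotientMap.

Lemma quotient_pts_inj (R : comAlgType k) (x y : quotient_pts R) :
  (forall u, x u = y u) -> x = y.
Proof.
case: x y => [x xC xD xM] [y yC yD yM] /= /funext xy; subst y.
by congr QuotientPt; exact: Prop_irrelevance.
Qed.

Fact quotient_id (R : comAlgType k) (x : quotient_pts R) :
  quotient_map (idfun : {lrmorphism R -> R}) x = x.
Proof. exact: quotient_pts_inj. Qed.

Fact quotient_comp (R S T : comAlgType k) (f : {lrmorphism R -> S})
    (g : {lrmorphism S -> T}) (x : quotient_pts R) :
  quotient_map (g \o f : {lrmorphism R -> T}) x =
  quotient_map g (quotient_map f x).
Proof. exact: quotient_pts_inj. Qed.

Definition quotient_group : kfunctor k := KFunctor quotient_id quotient_comp.

Definition quotient_proj_pts (R : comAlgType k) (g : G R) : quotient_pts R :=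
  @QuotientPt R (fun u => u R g) (fun _ => erefl) (fun _ _ => erefl)
    (fun _ _ => erefl).

Fact quotient_proj_nat (R S : comAlgType k) (f : {lrmorphism R -> S}) (g : G R) :
  quotient_proj_pts (fmap G f g) = fmap quotient_group f (quotient_proj_pts g).
Proof. by apply: quotient_pts_inj => u; exact: rf_nat. Qed.

Definition quotient_proj : kmap G quotient_group :=
  @KMap k G quotient_group quotient_proj_pts quotient_proj_nat.

Lemma quotient_projM (R : comAlgType k) (g h : gpts G R) :
  H h -> quotient_proj R (g * h)%g = quotient_proj R g.
Proof. by move=> Hh; apply: quotient_pts_inj => u; exact: invP. Qed.

End Quotient.

Section GL1.
Variables (k : fieldType) (A : falgType k).

Fact GL1_subproof (R S : comAlgType k) (f : {lrmorphism R -> S})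
    (x y : tensor A R) : x * y = 1 -> tensor_map f x * tensor_map f y = 1.
Proof. by move=> xy; rewrite -tensor_mapM xy tensor_map1. Qed.

Definition GL1_map (R S : comAlgType k) (f : {lrmorphism R -> S})
    (u : units (tensor A R)) : units (tensor A S) :=
  unit_of (GL1_subproof f (uvalV u)) (GL1_subproof f (uinvK u)).

Fact GL1_id (R : comAlgType k) (u : units (tensor A R)) :
  GL1_map (idfun : {lrmorphism R -> R}) u = u.
Proof. by apply: units_inj; apply/ffunP=> i; rewrite ffunE. Qed.

Fact GL1_comp (R S T : comAlgType k) (f : {lrmorphism R -> S})
    (g : {lrmorphism S -> T}) (u : units (tensor A R)) :
  GL1_map (g \o f : {lrmorphism R -> T}) u = GL1_map g (GL1_map f u).
Proof. by apply: units_inj; apply/ffunP=> i; rewrite !ffunE. Qed.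

Fact GL1_mul (R S : comAlgType k) (f : {lrmorphism R -> S})
    (u v : units (tensor A R)) :
  GL1_map f (u * v)%g = (GL1_map f u * GL1_map f v)%g.
Proof. by apply: units_inj; exact: tensor_mapM. Qed.

Definition GL1 : kgroup k := KGroup GL1_id GL1_comp GL1_mul.

End GL1.

Section TensorHom.
Variables (k : fieldType) (A B : falgType k).

Fact tensor_hom_subproof (R : comAlgType k) (a a' : tensor A R)
    (b b' : tensor B R) : a * a' = 1 -> b * b' = 1 ->
  tensor_ext a b * tensor_ext a' b' = 1.
Proof. by move=> aV bV; rewrite tensor_extM aV bV tensor_ext1. Qed.

Definition tensor_hom_pts (R : comAlgType k) (p : kprod (GL1 A) (GL1 B) R) :
    GL1 (tensor A B) R :=
  unit_of (tensor_hom_subproof (uvalV p.1) (uvalV p.2))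
          (tensor_hom_subproof (uinvK p.1) (uinvK p.2)).

Fact tensor_hom_nat (R S : comAlgType k) (f : {lrmorphism R -> S})
    (p : kprod (GL1 A) (GL1 B) R) :
  tensor_hom_pts (fmap (kprod (GL1 A) (GL1 B)) f p) =
  fmap (GL1 (tensor A B)) f (tensor_hom_pts p).
Proof. by apply: units_inj; rewrite /uval /= -tensor_ext_map. Qed.

(* The homomorphism j : GL_1(A) x GL_1(B) -> GL_1(A (x) B), with image
   H(A, B). *)
Definition tensor_hom : kmap (kprod (GL1 A) (GL1 B)) (GL1 (tensor A B)) :=
  KMap tensor_hom_nat.

Lemma tensor_homM (R : comAlgType k) (a a' : gpts (GL1 A) R)
    (b b' : gpts (GL1 B) R) :
  tensor_hom R ((a * a')%g, (b * b')%g) =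
  (tensor_hom R (a, b) * tensor_hom R (a', b'))%g.
Proof. by apply: units_inj; rewrite /uval /= -tensor_extM. Qed.

Definition Q : kfunctor k :=
  quotient_group (G := GL1 (tensor A B)) (image_pts tensor_hom).

End TensorHom.

(* Main.v *)
From HB Require Import structures.
Require Import Defs.
From mathcomp Require Import all_boot all_order all_fingroup all_algebra all_field.
From mathcomp Require Import boolp mpoly ring.

Set Implicit Arguments.
Unset Strict Implicit.
Unset Printing Implicit Defensive.

Import GRing.Theory.
Local Open Scope ring_scope.

(** Let a and b be the dimensions of A and B.  Since they are coprime there are
n and m with n a = 1 + b m, and one may take m < a.  The proof turns the
coincidence of the numbers n a and 1 + b m into a map from A (x) B to lines.

Choose a k-linear map from A^n onto k^(n a - 1) = B^m whose kernel is the line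
of (1, 0, ..., 0) ([drop_entry]).  A tensor w acts by sending u in A^n first to
w u in A^n (x) B, and then, by the B-linear extension of the chosen map, to B^m
([pairing]).  This is a linear map in u from dimension n a to dimension
n a - 1, so for general w its kernel is a line, spanned by the vector of signed
maximal minors ([kernel_vector]).  Replacing w by w (alpha (x) beta) divides
the line by alpha and does not see beta, because the pairing is A-balanced and
B-linear ([pairing_regmx], [pairing_actB], [kernel_vector_act]).

Conversely, for a general u, the tensors w that kill u form the space of
solutions of m equations over B in the a unknowns of A (x) B = B^a; it is a
free B-module of rank a - m, and B^* acts on it by scaling.  So an orbit of
A^* x B^* in general position contains exactly one w such that the first entry
of u, an element of A, is 1, and such that the first entry of w, an element of
B, is 1.  The other n - 1 entries of u and the a - m - 1 coordinates of the
solution w are free.  Hence the affine space of dimension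
a (n - 1) + b (a - m - 1) is a rational slice for the action ([slice]).  None
of the determinants that have to be invertible vanishes identically, because
the slice passes through w = 1, where all of them are 1 ([kernel_vector1],
[sysmx1], [slice1]).

To reach the quotient itself, whose coordinate ring consists of functions that
are invariant on the nose and under the closed image of j, two more points are
needed.  First, the normalized u and w of a tensor, multiplied by the norms of
the entries that were made equal to 1, are polynomial in the tensor, and the
pure tensors act on them through powers of the norm of A (x) B; dividing by
these powers, one gets invariant functions ([inv_kernel_coords_act],
[inv_shift_coords_act]).  That only powers of this norm occur is again the
equation n a = 1 + b m ([det_scale_regmx]).  Secondly, the closed image of j
has no more points than pure tensors: the equations that the above
construction gives for pure tensors already force a tensor to be pure
([image_tensorP]).

Finally, the coordinate ring of the quotient is a ring of functions on an open
subset of an affine space, so that it embeds into a field of rational functions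
by evaluation at the generic unit ([generic_unitP]).  Identities between
invariant functions then have to be checked at that one point only, and the
criterion [birational_of_slice] gives the theorem. *)

(** * Flattening matrices into row vectors *)

Lemma index_allpairs_pair (T1 T2 : eqType) (s : seq T1) (t : seq T2) x y :
  x \in s -> y \in t ->
  index (x, y) [seq (x1, x2) | x1 <- s, x2 <- t] =
  (index x s * size t + index y t)%N.
Proof.
move=> xs yt; elim: s => [//|x0 s IH] in xs *; rewrite allpairs_cons index_cat /=.
have [<-|x0x] := eqVneq x0 x.
  by rewrite map_f // index_map // => u v [].
rewrite inE eq_sym (negbTE x0x) /= in xs.
rewrite ifN ?IH ?size_map ?mulSn ?addnA //.
by apply/mapP => -[z _ [xx0 _]]; rewrite xx0 eqxx in x0x.
Qed.

Lemma mxvec_indexE p q (i : 'I_p) (j : 'I_q) : mxvec_index i j = (i * q + j)%N :> nat.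
Proof.
rewrite /= /enum_rank enum_rank_in.unlock insubdK; last first.
  by rewrite -topredE /= cardE index_mem mem_enum.
rewrite enumT unlock /= index_allpairs_pair ?mem_enum //.
by rewrite !index_enum_ord size_enum_ord.
Qed.

(** Matrices are flattened row by row, so that a vector in the first row keeps
its coordinates. *)
Lemma mxvec_delta0 (R : pzSemiRingType) p q (l : 'I_q) (t : 'I_(p.+1 * q)) :
  mxvec (delta_mx 0 l : 'M[R]_(p.+1, q)) 0 t = (t == l :> nat)%:R.
Proof.
case/mxvec_indexP: t => i j; rewrite mxvecE mxE; congr (nat_of_bool _)%:R.
have -> : (l : nat) = mxvec_index (0 : 'I_p.+1) l by rewrite mxvec_indexE.
apply/andP/eqP => [[/eqP-> /eqP->] // | /val_inj/cast_ord_inj/enum_rank_inj[-> ->]].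
by rewrite !eqxx.
Qed.

(** * Adjugates, and determinants of left and right multiplications *)

Section Determinants.
Variable R : comNzRingType.

Definition set_col n (A : 'M[R]_n) (i : 'I_n) (y : 'cV[R]_n) : 'M[R]_n :=
  \matrix_(r, c) if c == i then y r 0 else A r c.

Lemma det_set_col n (A : 'M[R]_n) i y :
  \det (set_col A i y) = (\adj A *m y) i 0.
Proof.
rewrite (expand_det_col _ i) mxE; apply: eq_bigr => r _.
rewrite !mxE eqxx mulrC; congr (_ * _); rewrite /cofactor; congr (_ * \det _).
by apply/matrixP=> p q; rewrite !mxE eq_sym (negbTE (neq_lift _ _)).
Qed.

(** Over a general ring G and A cannot be inverted.  The identity is read off
columns instead: by Cramer's rule [\adj M *m y] lists the determinants of M
with one column replaced by y, and G can be factored out of such a matrix. *)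
Lemma adj_mull n (G A : 'M[R]_n) : \adj (G *m A) *m G = \det G *: \adj A.
Proof.
suff E (y : 'cV_n) : \adj (G *m A) *m (G *m y) = \det G *: (\adj A *m y).
  apply/matrixP=> i j; have /matrixP/(_ i 0) := E (delta_mx j 0).
  rewrite mulmxA scalemxAl => E'.
  by move: E'; rewrite -!colE ![col _ _ _ _]mxE.
apply/matrixP=> i j; rewrite ord1 [RHS]mxE -!det_set_col -det_mulmx; congr (\det _).
apply/matrixP=> r c; rewrite !mxE; case: (c =P i) => [->|/eqP ci]; last first.
  by apply: eq_bigr => s _; rewrite !mxE (negbTE ci).
by apply: eq_bigr => s _; rewrite !mxE eqxx.
Qed.

Lemma adj_mulr n (A G : 'M[R]_n) : G *m \adj (A *m G) = \det G *: \adj A.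
Proof.
apply: trmx_inj; rewrite trmx_mul trmx_adj trmx_mul adj_mull.
by rewrite det_tr linearZ /= trmx_adj.
Qed.

Lemma det_change_basis p q (A : 'M[R]_(p, q)) (B : 'M[R]_(q, p)) (X : 'M[R]_p) :
  p = q -> A *m B = 1%:M -> \det (B *m X *m A) = \det X.
Proof.
move=> pq AB; case: q / pq A B AB => A B AB.
by rewrite !det_mulmx mulrC mulrA -det_mulmx AB det1 mul1r.
Qed.

Lemma lin_mx_comp m1 n1 m2 n2 m3 n3 (f : {linear 'M[R]_(m1, n1) -> 'M[R]_(m2, n2)})
    (g : {linear 'M[R]_(m2, n2) -> 'M[R]_(m3, n3)}) :
  lin_mx f *m lin_mx g = lin_mx (g \o f).
Proof.
apply/row_matrixP=> i; rewrite !rowE.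
by rewrite mulmxA -[delta_mx _ _]vec_mxK !mul_vec_lin /=.
Qed.

Lemma lin_mx_eq m1 n1 m2 n2 (f g : {linear 'M[R]_(m1, n1) -> 'M[R]_(m2, n2)}) :
  f =1 g -> lin_mx f = lin_mx g.
Proof.
move=> fg; apply/row_matrixP=> i; rewrite !rowE.
by rewrite -[delta_mx _ _]vec_mxK !mul_vec_lin /= fg.
Qed.

Lemma lin_mx_id m n : lin_mx (idfun : 'M[R]_(m, n) -> _) = 1%:M.
Proof.
apply/row_matrixP=> i; rewrite !rowE mulmx1.
by rewrite -[delta_mx _ _]vec_mxK mul_vec_lin.
Qed.

(** In the basis of matrix units, right multiplication is block diagonal with one
block P for each row. *)
Lemma det_lin_mulmxr n a (P : 'M[R]_a) :
  \det (lin_mx (mulmxr P : 'M[R]_(n, a) -> _)) = \det P ^+ n.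
Proof.
elim: n => [|n IH]; first by rewrite det_mx00.
pose f (v : 'rV[R]_(a + n * a)) := col_mx (lsubmx v) (vec_mx (rsubmx v)) : 'M_(1 + n, a).
pose g (Y : 'M[R]_(1 + n, a)) := row_mx (usubmx Y) (mxvec (dsubmx Y)).
have f_lin : linear f.
  by move=> t u v; rewrite /f !linearP scale_col_mx add_col_mx.
have g_lin : linear g.
  by move=> t u v; rewrite /g !linearP scale_row_mx add_row_mx.
pose fL := GRing.isLinear.Build _ _ _ _ f f_lin.
pose gL := GRing.isLinear.Build _ _ _ _ g g_lin.
pose fl : {linear _ -> _} := HB.pack f fL.
pose gl : {linear _ -> _} := HB.pack g gL.
pose A := lin1_mx (mxvec \o fl); pose B := lin1_mx (gl \o vec_mx).
have AB : A *m B = 1%:M.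
  apply/row_matrixP=> i; rewrite !rowE mulmx1 mulmxA !mul_rV_lin1 /= mxvecK.
  by rewrite /g /f col_mxKu col_mxKd vec_mxK hsubmxK.
pose X := block_mx P 0 0 (lin_mx (mulmxr P : 'M[R]_(n, a) -> _)).
have -> : lin_mx (mulmxr P : 'M[R]_(1 + n, a) -> _) = B *m X *m A.
  apply/row_matrixP=> i; rewrite !rowE !mulmxA -[delta_mx 0 i]vec_mxK mul_vec_lin.
  rewrite mul_rV_lin1 /= [mxvec _ *m B]mul_rV_lin1 /= mxvecK mul_row_block.
  rewrite !mulmx0 addr0 add0r mul_vec_lin /f row_mxKl row_mxKr mxvecK /=.
  by congr mxvec; rewrite -mul_col_mx vsubmxK.
by rewrite det_change_basis // det_ublock IH exprS.
Qed.

Lemma det_lin_mulmx m n (S : 'M[R]_m) :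
  \det (lin_mx (mulmx S : 'M[R]_(m, n) -> _)) = \det S ^+ n.
Proof.
pose A := lin_mx (@trmx R n m); pose B := lin_mx (@trmx R m n).
have AB : A *m B = 1%:M.
  by rewrite lin_mx_comp -lin_mx_id; apply: lin_mx_eq => x /=; rewrite trmxK.
have -> : lin_mx (mulmx S : 'M[R]_(m, n) -> _) = B *m lin_mx (mulmxr S^T) *m A.
  rewrite !lin_mx_comp; apply: lin_mx_eq => x /=.
  by rewrite trmx_mul !trmxK.
by rewrite det_change_basis ?det_lin_mulmxr ?det_tr // mulnC.
Qed.

End Determinants.

(** * The kernel of a map with one more row than columns *)

Section Cramer.
Variables (R : comNzRingType) (N : nat).

(** The signed maximal minors of M, as the cofactors of the column that is
missing to make M square; they do not depend on that column. *)
Definition cramer_row (M : 'M[R]_(1 + N, N)) : 'rV[R]_(1 + N) :=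
  \row_i cofactor (row_mx 0 M : 'M_(1 + N)) i 0.

Lemma cramer_rowE M (y : 'cV[R]_(1 + N)) :
  cramer_row M *m y = (\det (row_mx y M))%:M.
Proof.
apply/matrixP=> i j; rewrite !ord1 [RHS]mxE eqxx mulr1n (expand_det_col _ 0) mxE.
apply: eq_bigr => r _; rewrite mulrC mxE.
have -> : row_mx y M r 0 = y r 0.
  by rewrite -(row_mxEl y M r 0); congr (row_mx _ _ _ _); apply: val_inj.
congr (_ * _); rewrite /cofactor; congr (_ * \det _).
by apply/matrixP=> p q; rewrite !mxE; case: splitP => // s /=; rewrite ord1.
Qed.

(** A vector in the kernel of M is proportional to the vector of minors.  The
product of z with the square matrix (y | M) is (z y, 0); multiply it by the
adjugate of (y | M), whose first row consists of the minors of M. *)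
Lemma cramer_row_uniq M (y : 'cV[R]_(1 + N)) (z : 'rV[R]_(1 + N)) :
  z *m M = 0 -> (z *m y) 0 0 *: cramer_row M = \det (row_mx y M) *: z.
Proof.
move=> zM; have /(congr1 (mulmx^~ (\adj (row_mx y M)))) := mul_mx_row z y M.
rewrite -mulmxA mul_mx_adj mul_mx_scalar => ->; rewrite zM.
apply/rowP=> j; rewrite mxE [RHS]mxE big_ord_recl big1 ?addr0 => [|i _]; last first.
  by rewrite mxE; case: splitP => k /=; rewrite ?(ord1 k) // mxE mul0r.
rewrite -[X in X * _](row_mxEl _ (0 : 'rV_N) 0 0); congr (_ * _).
  by congr (row_mx _ _ _ _); apply: val_inj.
rewrite mxE [RHS]mxE /cofactor; congr (_ * \det _).
by apply/matrixP=> p q; rewrite !mxE; case: splitP => // s /=; rewrite ord1.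
Qed.

(** A general column of a square matrix G M H can be written G y, and the
resulting (G y | G M H) is the product of G, of (y | M) and of the diagonal
block matrix of 1 and H. *)
Lemma cramer_row_mul (G : 'M[R]_(1 + N)) M (H : 'M[R]_N) :
  cramer_row (G *m M *m H) *m G = (\det G * \det H) *: cramer_row M.
Proof.
suff E (y : 'cV_(1 + N)) :
    cramer_row (G *m M *m H) *m G *m y = (\det G * \det H) *: cramer_row M *m y.
  by apply/rowP=> j; have /matrixP/(_ 0 0) := E (delta_mx j 0); rewrite -!colE ![col _ _ _ _]mxE.
rewrite -mulmxA -scalemxAl !cramer_rowE -mulmxA.
have -> : row_mx (G *m y) (G *m (M *m H)) = G *m row_mx y M *m block_mx 1%:M 0 0 H.
  by rewrite mul_mx_row mul_row_block !mulmx1 !mulmx0 addr0 add0r mulmxA.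
rewrite !det_mulmx (det_ublock (1%:M : 'M_1)) det1 mul1r scale_scalar_mx.
by rewrite mulrAC.
Qed.

End Cramer.

Section CramerCast.
Variables (R : comNzRingType) (p N : nat) (e : p = (1 + N)%N).

(** The number of rows will be n a, equal to 1 + b m only by a proof; hence the
cast. *)
Definition cramer (M : 'M[R]_(p, N)) : 'rV[R]_p :=
  castmx (erefl, esym e) (cramer_row (castmx (e, erefl) M)).

End CramerCast.

Lemma mulmx_castmx_col (R : pzRingType) p N (e : p = (1 + N)%N) (v : 'rV[R]_p) :
  v *m castmx (esym e, erefl) (col_mx 0 1%:M) = rsubmx (castmx (erefl, e) v).
Proof.
move: (e) v; rewrite e => e0 v; rewrite (eq_axiomK e0) /= !castmx_id.
by rewrite -{1}[v]hsubmxK mul_row_col mulmx0 add0r mulmx1.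
Qed.

Section CramerTheory.
Variables (R : comNzRingType) (p N : nat) (e : p = (1 + N)%N).
Implicit Types (M : 'M[R]_(p, N)).

Lemma cramer_ker M : cramer e M *m M = 0.
Proof.
rewrite /cramer; move: (e) M; rewrite e => e0 M.
rewrite (eq_axiomK e0) /= !castmx_id.
suff E j : cramer_row M *m col j M = 0.
  apply/matrixP=> i j; have /matrixP/(_ i 0) := E j; rewrite !mxE => E'.
  by rewrite -[RHS]E'; apply: eq_bigr => s _; rewrite !mxE.
rewrite cramer_rowE -det_tr (determinant_alternate (i1 := lshift N 0) (i2 := rshift 1 j)).
- by rewrite raddf0.
- by rewrite eq_lrshift.
by move=> i; rewrite mxE row_mxEl [RHS]mxE row_mxEr mxE.
Qed.

Lemma cramer_mul (G : 'M[R]_p) M (H : 'M[R]_N) :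
  cramer e (G *m M *m H) *m G = (\det G * \det H) *: cramer e M.
Proof.
rewrite /cramer; move: (e) G M; rewrite e => e0 G M.
by rewrite (eq_axiomK e0) /= !castmx_id cramer_row_mul.
Qed.

Lemma cramer_uniq M (z : 'rV[R]_p) (y : 'cV[R]_p) :
  z *m M = 0 -> (z *m y) 0 0 *: cramer e M = (cramer e M *m y) 0 0 *: z.
Proof.
rewrite /cramer; move: (e) M z y; rewrite e => e0 M z y.
rewrite (eq_axiomK e0) /= !castmx_id => zM.
by rewrite cramer_row_uniq // cramer_rowE mxE eqxx.
Qed.

(** The deletion of the first coordinate, with the line of the first basis vector
as its kernel. *)
Lemma cramer_pid : cramer e (castmx (esym e, erefl) (col_mx 0 1%:M)) =
  castmx (erefl, esym e) (row_mx 1%:M 0) :> 'rV[R]_p.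
Proof.
rewrite /cramer castmxKV; congr castmx.
suff E (y : 'cV_(1 + N)) :
    cramer_row (col_mx 0 1%:M) *m y = row_mx 1%:M 0 *m y :> 'M[R]_1.
  by apply/rowP=> j; have /matrixP/(_ 0 0) := E (delta_mx j 0); rewrite -!colE ![col _ _ _ _]mxE.
rewrite cramer_rowE -[y]vsubmxK -(block_mxEh (usubmx y)) det_lblock det1 mulr1.
rewrite mul_row_col mul1mx mul0mx addr0 [usubmx y in LHS]mx11_scalar.
by rewrite det_scalar1 -mx11_scalar.
Qed.

End CramerTheory.

Lemma map_cramer (R S : comNzRingType) (f : {rmorphism R -> S}) (p N : nat)
    (e : p = (1 + N)%N) (M : 'M[R]_(p, N)) :
  map_mx f (cramer e M) = cramer e (map_mx f M).
Proof.
rewrite /cramer; move: (e) M; rewrite e => e0 M.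
rewrite (eq_axiomK e0) /= !castmx_id; apply/rowP=> j.
rewrite !mxE /cofactor rmorphM rmorphXn rmorphN1 -det_map_mx; congr (_ * \det _).
by rewrite map_row' map_col' map_row_mx map_mx0.
Qed.

(** * Finite dimensional commutative algebras in coordinates *)

Section RegularRepresentation.
Variables (k : fieldType) (d : nat) (rho : 'I_d -> 'M[k]_d).

(** [rho i] is the matrix of multiplication by the i-th basis vector, acting on
row vectors. *)
Definition regmx (R : comAlgType k) (c : 'rV[R]_d) : 'M[R]_d :=
  \sum_i c 0 i *: map_mx (in_alg R) (rho i).

Fact regmx_is_linear (R : comAlgType k) : linear (@regmx R).
Proof.
move=> t u v; rewrite /regmx scaler_sumr -big_split; apply: eq_bigr => i _ /=.
by rewrite !mxE scalerDl scalerA.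
Qed.
HB.instance Definition _ (R : comAlgType k) :=
  GRing.isLinear.Build R _ _ _ (@regmx R) (@regmx_is_linear R).

Lemma regmxZ (R : comAlgType k) t (c : 'rV[R]_d) : regmx (t *: c) = t *: regmx c.
Proof. exact: (linearZZ (@regmx R)). Qed.

Lemma map_regmx (R S : comAlgType k) (f : {lrmorphism R -> S}) (c : 'rV[R]_d) :
  map_mx f (regmx c) = regmx (map_mx f c).
Proof.
rewrite /regmx raddf_sum; apply: eq_bigr => i _; apply/matrixP=> p q.
by rewrite !mxE /= rmorphM; congr (_ * _); exact: rmorph_alg.
Qed.

Lemma regmx_delta (R : comAlgType k) i :
  regmx (delta_mx 0 i : 'rV[R]_d) = map_mx (in_alg R) (rho i).
Proof.
rewrite /regmx (bigD1 i) //= mxE !eqxx scale1r big1 ?addr0 // => j ji.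
by rewrite mxE (negbTE ji) andbF scale0r.
Qed.

Lemma regmx_expand (R : comAlgType k) (c : 'rV[R]_d) :
  regmx c = \sum_i c 0 i *: regmx (delta_mx 0 i).
Proof. by rewrite {1}/regmx; apply: eq_bigr => i _; rewrite regmx_delta. Qed.

End RegularRepresentation.

(** The conditions under which the matrices [rho] are the multiplications of a
commutative algebra: the first basis vector is the unit, the product is
commutative, and it is associative. *)
Definition com_unit_table (k : fieldType) d (rho : 'I_(1 + d) -> 'M[k]_(1 + d)) :=
  [/\ rho 0 = 1%:M, forall i j, row j (rho i) = row i (rho j)
    & forall i j, rho i *m rho j = \sum_l rho j i l *: rho l].

Section ComRegular.
Variables (k : fieldType) (d : nat) (rho : 'I_(1 + d) -> 'M[k]_(1 + d)).
Hypothesis rhoP : com_unit_table rho.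
Variable R : comAlgType k.
Implicit Types c : 'rV[R]_(1 + d).
Local Notation P := (regmx rho).

Lemma regmx1 : P (delta_mx 0 0 : 'rV[R]_(1 + d)) = 1%:M.
Proof. by case: rhoP => r1 _ _; rewrite regmx_delta r1 map_mx1. Qed.

Lemma regmx_sym c c' : c *m P c' = c' *m P c.
Proof.
case: rhoP => _ rC _; rewrite /regmx !mulmx_sumr.
under eq_bigr => i _ do rewrite -scalemxAr mulmx_sum_row scaler_sumr.
under [RHS]eq_bigr => i _ do rewrite -scalemxAr mulmx_sum_row scaler_sumr.
rewrite exchange_big; apply: eq_bigr => i _; apply: eq_bigr => j _ /=.
by rewrite -!map_row rC !scalerA mulrC.
Qed.

Lemma regmx_mul c c' : P (c *m P c') = P c *m P c'.
Proof.
case: rhoP => _ _ rM.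
have rMR i j : map_mx (in_alg R) (rho i) *m map_mx (in_alg R) (rho j) =
    P (row i (map_mx (in_alg R) (rho j))).
  rewrite -map_mxM rM /regmx raddf_sum; apply: eq_bigr => l _ /=.
  by apply/matrixP=> p q; rewrite !mxE rmorphM.
rewrite mulmx_sum_row linear_sum {1}[P c]/regmx mulmx_suml.
apply: eq_bigr => i _ /=; rewrite regmxZ -scalemxAl; congr (_ *: _).
have -> : row i (P c') = \sum_j c' 0 j *: row i (map_mx (in_alg R) (rho j)).
  by rewrite /regmx linear_sum; apply: eq_bigr => j _; rewrite linearZ.
rewrite linear_sum [in RHS]/regmx mulmx_sumr; apply: eq_bigr => j _ /=.
by rewrite -scalemxAr rMR regmxZ.
Qed.

Lemma regmx_comm c c' : P c *m P c' = P c' *m P c.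
Proof. by rewrite -!regmx_mul regmx_sym. Qed.

Lemma mul1_regmx c : delta_mx 0 0 *m P c = c.
Proof. by rewrite regmx_sym regmx1 mulmx1. Qed.

(** The inverse of an element, when it exists, is an element of the algebra, so
that the adjugate is a multiplication too; the vector on the right is the image
of 1 under the adjugate. *)
Lemma regmx_adj c t : \det (P c) * t = 1 ->
  \adj (P c) = P (delta_mx 0 0 *m \adj (P c)).
Proof.
move=> ct; have E : P (delta_mx 0 0 *m \adj (P c)) *m P c = (\det (P c))%:M.
  by rewrite -regmx_mul -mulmxA mul_adj_mx mul_mx_scalar regmxZ regmx1 scalemx1.
set w := P _ in E *; have := congr1 (mulmx^~ (t *: \adj (P c))) E.
rewrite -mulmxA -scalemxAr mul_mx_adj scale_scalar_mx mulrC ct mulmx1 => ->.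
by rewrite mul_scalar_mx scalerA ct scale1r.
Qed.

End ComRegular.

(** * An equivariant map from tensors to lines, and a slice of it *)

(** Over a ring R of scalars, A (x) B is the module of b by a matrices, on which
B acts from the left through [actB] and A from the right through [regmx].  The
rows of an n by a matrix form an element of A^n, and the columns of a b by m
matrix form an element of B^m.  Both 1 in A (x) B and (1, 0, ..., 0) in A^n are
the matrix unit [delta_mx 0 0]. *)
Section Slice.
Variables (k : fieldType) (m c n' b' : nat).
Local Notation a := (1 + (m + c))%N.
Local Notation n := (1 + n')%N.
Local Notation b := (1 + b')%N.
Variables (rhoA : 'I_a -> 'M[k]_a) (rhoB : 'I_b -> 'M[k]_b).
Hypothesis e : (n * a = 1 + b * m)%N.

Section Definitions.
Variable R : comAlgType k.

Definition actB (s : 'rV[R]_b) : 'M[R]_b := (regmx rhoB s)^T.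

(** Of the linear maps from A^n to B^m with the line of (1, 0, ..., 0) as their
kernel, this one sends the basis vectors 1, ..., m of the first copy of A to
the standard B-basis of B^m.  Therefore the equations of the slice are already
solved at the base point ([sysmx1]). *)
Definition drop_entry (u : 'M[R]_(n, a)) : 'M[R]_(b, m) :=
  vec_mx (rsubmx (castmx (erefl, e) (mxvec u))).

(** Writing X as the sum of its columns X_l in B times the basis vectors e_l of
A, this is the sum of the X_l times the images of e_l u under [drop_entry]. *)
Definition pairing (X : 'M[R]_(b, a)) (u : 'M[R]_(n, a)) : 'M[R]_(b, m) :=
  \sum_l actB (col l X)^T *m drop_entry (u *m regmx rhoA (delta_mx 0 l)).

Definition kernel_vector (X : 'M[R]_(b, a)) : 'M[R]_(n, a) :=
  vec_mx (cramer e (lin_mx (pairing X))).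

Definition kernel_head (X : 'M[R]_(b, a)) : 'rV[R]_a := row 0 (kernel_vector X).

(** The kernel vector divided by its first entry, an element of A, and multiplied
by the norm of that entry: the adjugate is the inverse times the norm. *)
Definition kernel_coords (X : 'M[R]_(b, a)) : 'M[R]_(n, a) :=
  kernel_vector X *m \adj (regmx rhoA (kernel_head X)).

(** The tensor multiplied by the element of A that brings the first entry of its
kernel vector to 1. *)
Definition shift (X : 'M[R]_(b, a)) : 'M[R]_(b, a) := X *m regmx rhoA (kernel_head X).

Definition shift_head (X : 'M[R]_(b, a)) : 'rV[R]_b := (col 0 (shift X))^T.

(** As for [kernel_coords], the shifted tensor divided by its first coordinate in
B, and multiplied by the norm of that coordinate. *)
Definition shift_coords (X : 'M[R]_(b, a)) : 'M[R]_(b, a) :=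
  \adj (actB (shift_head X)) *m shift X.

(** The tensors (1 | Z | z) that kill u, for a given z, are the solutions of a
linear system in the unknown Z; this is its matrix. *)
Definition sysmx (u : 'M[R]_(n, a)) : 'M[R]_(b * m) :=
  lin_mx (fun Z : 'M[R]_(b, m) => pairing (row_mx 0 (row_mx Z 0)) u).

(** Cramer's solution (1 | Z | z) of [pairing _ u = 0], multiplied by the
determinant of the system to make it polynomial in u and z.  The extra factor
is harmless, as scalars belong to the group that is divided out. *)
Definition slice (u : 'M[R]_(n, a)) (z : 'M[R]_(b, c)) : 'M[R]_(b, a) :=
  row_mx (\det (sysmx u) *: delta_mx 0 0)
    (row_mx (vec_mx (- mxvec (pairing (row_mx (delta_mx 0 0) (row_mx 0 z)) u)
                       *m \adj (sysmx u)))
            (\det (sysmx u) *: z)).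

Fact drop_entry_is_linear : linear drop_entry.
Proof.
move=> t u v; rewrite /drop_entry linearP /=.
by apply/matrixP=> i j; rewrite !(mxE, castmxE).
Qed.
HB.instance Definition _ := GRing.isLinear.Build R _ _ _ drop_entry drop_entry_is_linear.

Fact pairing_is_linear X : linear (pairing X).
Proof.
move=> t u v; rewrite /pairing scaler_sumr -big_split; apply: eq_bigr => l _ /=.
by rewrite mulmxDl -scalemxAl linearP mulmxDr scalemxAr.
Qed.
HB.instance Definition _ X := GRing.isLinear.Build R _ _ _ (pairing X) (pairing_is_linear X).

Fact actB_is_linear : linear actB.
Proof. by move=> t u v; rewrite /actB !linearP. Qed.
HB.instance Definition _ := GRing.isLinear.Build R _ _ _ actB actB_is_linear.

Definition pairingr u X := pairing X u.
Fact pairingr_is_linear u : linear (pairingr u).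
Proof.
move=> t X Y; rewrite /pairingr /pairing scaler_sumr -big_split; apply: eq_bigr => l _ /=.
by rewrite !linearP /= mulmxDl scalemxAl.
Qed.
HB.instance Definition _ u := GRing.isLinear.Build R _ _ _ (pairingr u) (pairingr_is_linear u).

Definition pairing_mid u (Z : 'M[R]_(b, m)) := pairing (row_mx 0 (row_mx Z 0)) u.
Fact pairing_mid_is_linear u : linear (pairing_mid u).
Proof.
move=> t Z Z'; rewrite /pairing_mid -![pairing _ u]/(pairingr u _) -linearP /=.
by rewrite !(scale_row_mx, add_row_mx) !scaler0 !addr0.
Qed.
HB.instance Definition _ u :=
  GRing.isLinear.Build R _ _ _ (pairing_mid u) (pairing_mid_is_linear u).

End Definitions.

Hypotheses (rhoAP : com_unit_table rhoA) (rhoBP : com_unit_table rhoB).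

Section Theory.
Variable R : comAlgType k.
Local Notation P := (@regmx k a rhoA R).
Local Notation S := (@actB R).
Local Notation pairing := (@pairing R).
Implicit Types (X : 'M[R]_(b, a)) (u : 'M[R]_(n, a)) (p : 'rV[R]_a) (s : 'rV[R]_b).

Lemma actB1 : S (delta_mx 0 0) = 1%:M.
Proof. by rewrite /actB regmx1 // trmx1. Qed.

Lemma actB_mul s s' : S (S s *m s'^T)^T = S s *m S s'.
Proof. by rewrite /actB trmx_mul !trmxK regmx_mul // trmx_mul. Qed.

Lemma actB_delta s : S s *m delta_mx 0 0 = s^T.
Proof. by rewrite /actB -[delta_mx _ _]trmxK -trmx_mul trmx_delta mul1_regmx. Qed.

Lemma pairing_actB s X u : pairing (S s *m X) u = S s *m pairing X u.
Proof.
rewrite /pairing mulmx_sumr; apply: eq_bigr => l _.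
by rewrite mulmxA -actB_mul !colE -mulmxA trmxK.
Qed.

(** The pairing is balanced over A, since it depends on the product of X and u
only. *)
Lemma pairing_regmx p X u : pairing (X *m P p) u = pairing X (u *m P p).
Proof.
rewrite /pairing.
under eq_bigr => l _.
  have -> : col l (X *m P p) = \sum_j P p j l *: col j X.
    apply/colP=> i; rewrite !mxE summxE; apply: eq_bigr => j _.
    by rewrite !mxE mulrC.
  rewrite linear_sum /= linear_sum mulmx_suml /=.
  under eq_bigr => j _ do rewrite !linearZ /= -scalemxAl.
over.
rewrite exchange_big; apply: eq_bigr => j _ /=.
rewrite -mulmxA -regmx_comm // -regmx_mul // -rowE.
rewrite (regmx_expand _ (row j _)) mulmx_sumr linear_sum mulmx_sumr.
apply: eq_bigr => l _ /=.
by rewrite mxE -scalemxAr linearZ /= scalemxAr.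
Qed.

Lemma pairing1 u : pairing (delta_mx 0 0) u = drop_entry u.
Proof.
rewrite /pairing (bigD1 0) //= big1 ?addr0 => [|l l0]; last first.
  by rewrite (_ : col l _ = 0) ?linear0 ?mul0mx //; apply/colP=> i; rewrite !mxE (negbTE l0) andbF.
rewrite (_ : col 0 _ = delta_mx 0 0); last first.
  by apply/colP=> i; rewrite !mxE !andbT.
by rewrite trmx_delta actB1 mul1mx regmx1 // mulmx1.
Qed.

Lemma pairing_kernel X : pairing X (kernel_vector X) = 0.
Proof.
apply: (can_inj mxvecK); rewrite -mul_vec_lin /= /kernel_vector vec_mxK.
by rewrite cramer_ker linear0.
Qed.

Lemma kernel_vector_uniq X u i j : pairing X u = 0 ->
  u i j *: kernel_vector X = kernel_vector X i j *: u.
Proof.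
move=> Xu0; pose y : 'cV[R]_(n * a) := delta_mx (mxvec_index i j) 0.
have uE (v : 'M[R]_(n, a)) : (mxvec v *m y) 0 0 = v i j.
  by rewrite /y -colE mxE mxvecE.
rewrite -(uE u) -(uE (kernel_vector X)) /kernel_vector vec_mxK -linearZ /=.
have zM : mxvec u *m lin_mx (pairing X) = 0 by rewrite mul_vec_lin /= Xu0 linear0.
by rewrite (cramer_uniq e y zM) linearZ /= mxvecK.
Qed.

(** Acting by s in B and p in A composes the map of which the kernel is taken
with multiplication by p on the source A^n and by s on the target B^m, whose
determinants are the n-th power of the norm of p and the m-th power of the norm
of s. *)
Lemma kernel_vector_act s p X :
  kernel_vector (S s *m X *m P p) *m P p =
  (\det (S s) ^+ m * \det (P p) ^+ n) *: kernel_vector X.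
Proof.
apply: (can_inj mxvecK); rewrite linearZ /= /kernel_vector vec_mxK.
rewrite -(det_lin_mulmxr _ (P p)) -(det_lin_mulmx _ (S s)) mulrC -cramer_mul !lin_mx_comp /=.
rewrite -[LHS](mul_vec_lin (mulmxr (P p))) vec_mxK.
congr (cramer e _ *m _); apply: lin_mx_eq => u /=.
by rewrite -pairing_actB pairing_regmx.
Qed.

Lemma drop_entryE (u : 'M[R]_(n, a)) i j :
  drop_entry u i j = mxvec u 0 (cast_ord (esym e) (rshift 1 (mxvec_index i j))).
Proof. by rewrite !mxE castmxE cast_ord_id. Qed.

Lemma drop_entry_delta (q : 'I_a) i j :
  drop_entry (delta_mx 0 q : 'M[R]_(n, a)) i j = ((1 + (i * m + j))%N == q)%:R.
Proof. by rewrite drop_entryE mxvec_delta0 -(mxvec_indexE i j). Qed.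

Lemma drop_entry1 : drop_entry (delta_mx 0 0 : 'M[R]_(n, a)) = 0.
Proof. by apply/matrixP=> i j; rewrite drop_entry_delta mxE. Qed.

(** Here the condition m < a enters: the first m coordinates after the deleted
one are still in the first copy of A, and they fill the first row of a b by m
matrix. *)
Lemma drop_entry_shift (l : 'I_m) :
  drop_entry (delta_mx 0 (rshift 1 (lshift c l)) : 'M[R]_(n, a)) = delta_mx 0 l.
Proof.
apply/matrixP=> i j; rewrite drop_entry_delta mxE; congr (nat_of_bool _)%:R.
rewrite /= eqSS; apply/eqP/andP=> [il | [/eqP-> /eqP->] //]; split.
  rewrite -val_eqE /=; case: (nat_of_ord i) il => // i0 il.
  by have := ltn_ord l; rewrite -il mulSn -addnA ltnNge leq_addr.
apply/eqP/val_inj => /=; case: (nat_of_ord i) il => // i0 il.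
by have := ltn_ord l; rewrite -il mulSn -addnA ltnNge leq_addr.
Qed.

Lemma kernel_vector1 : kernel_vector (delta_mx 0 0) = delta_mx 0 0 :> 'M[R]_(n, a).
Proof.
rewrite /kernel_vector.
have -> : lin_mx (pairing (delta_mx 0 0)) = castmx (esym e, erefl) (col_mx 0 1%:M).
  apply/row_matrixP=> t; rewrite !rowE mulmx_castmx_col.
  by rewrite -[delta_mx _ _]vec_mxK mul_vec_lin /= pairing1 /drop_entry vec_mxK.
rewrite cramer_pid; apply: (can_inj mxvecK); rewrite vec_mxK.
apply/rowP=> t; rewrite mxvec_delta0 castmxE cast_ord_id mxE esymK /=.
by case: splitP => j /= ->; rewrite mxE // ord1.
Qed.

(** The action of a pure tensor of s and p, with p' the inverse of p.  The scalar
[kappa] is the norm of the pure tensor. *)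
Section Orbit.
Variables (s : 'rV[R]_b) (p p' : 'rV[R]_a) (X : 'M[R]_(b, a)).
Hypothesis pp' : P p *m P p' = 1%:M.
Local Notation chi := (\det (S s) ^+ m * \det (P p) ^+ n).
Local Notation kappa := (\det (S s) ^+ a * \det (P p) ^+ b).

Lemma kernel_head_act : kernel_head (S s *m X *m P p) *m P p = chi *: kernel_head X.
Proof. by rewrite /kernel_head -row_mul kernel_vector_act linearZ. Qed.

Lemma regmx_kernel_head_act : P (kernel_head (S s *m X *m P p)) *m P p = chi *: P (kernel_head X).
Proof. by rewrite -regmx_mul // kernel_head_act regmxZ. Qed.

(** The first entry of the kernel vector changes by [chi] and the inverse of p, so
that its norm changes by the left-hand side.  Comparing the exponents of the
norm of p gives n a - 1 = b m. *)
Lemma det_scale_regmx : chi ^+ a * \det (P p') = kappa ^+ m.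
Proof.
have dd : \det (P p) * \det (P p') = 1 by rewrite -det_mulmx pp' det1.
rewrite !exprMn -!exprM e exprD expr1 -!mulrA; congr (_ * _); first by rewrite mulnC.
by rewrite mulrCA dd mulr1.
Qed.

Lemma kernel_coords_act : kernel_coords (S s *m X *m P p) = kappa ^+ m *: kernel_coords X.
Proof.
rewrite -det_scale_regmx -detZ /kernel_coords.
have -> : kernel_vector (S s *m X *m P p) = kernel_vector X *m (chi *: P p').
  by rewrite -scalemxAr scalemxAl -kernel_vector_act -[_ *m P p *m P p']mulmxA pp' mulmx1.
have -> : P (kernel_head (S s *m X *m P p)) = P (kernel_head X) *m (chi *: P p').
  by rewrite -scalemxAr scalemxAl -regmx_kernel_head_act -[_ *m P p *m P p']mulmxA pp' mulmx1.
by rewrite -mulmxA adj_mulr scalemxAr.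
Qed.

Lemma shift_act : shift (S s *m X *m P p) = chi *: S s *m shift X.
Proof.
rewrite /shift -[_ *m P p *m _]mulmxA regmx_comm // regmx_kernel_head_act.
by rewrite -scalemxAr -mulmxA scalemxAl.
Qed.

Lemma actB_shift_head_act :
  S (shift_head (S s *m X *m P p)) = chi *: S s *m S (shift_head X).
Proof.
rewrite /shift_head shift_act -!scalemxAl -actB_mul trmxK !colE -scalemxAl linearZ linearZ /=.
by rewrite mulmxA.
Qed.

Lemma shift_coords_act : shift_coords (S s *m X *m P p) = kappa ^+ n *: shift_coords X.
Proof.
have -> : kappa ^+ n = \det (chi *: S s).
  rewrite detZ !exprMn -!exprM [RHS]mulrAC -exprSr.
  by congr (_ ^+ _ * _ ^+ _); rewrite mulnC // e mulnC.
rewrite {1}/shift_coords actB_shift_head_act shift_act; set G := _ *: S s.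
by rewrite mulmxA adj_mull scalemxAl.
Qed.

End Orbit.

(** The norms by which [kernel_coords] and [shift_coords] differ from the
normalized vectors. *)
Definition kernel_norm X := \det (P (kernel_head X)).
Definition shift_norm X := \det (S (shift_head X)).

Lemma row0_kernel_coords X : row 0 (kernel_coords X) = kernel_norm X *: delta_mx 0 0.
Proof.
rewrite /kernel_coords row_mul -/(kernel_head X) -[X in X *m _](mul1_regmx rhoAP).
by rewrite -mulmxA mul_mx_adj mul_mx_scalar.
Qed.

Lemma col0_shift_coords X : col 0 (shift_coords X) = shift_norm X *: delta_mx 0 0.
Proof.
rewrite /shift_coords colE -mulmxA -colE -[col _ _]trmxK -/(shift_head X) -actB_delta.
by rewrite mulmxA mul_adj_mx mul_scalar_mx.
Qed.

Lemma kernel_coords00 X : kernel_coords X 0 0 = kernel_norm X.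
Proof.
by have /rowP/(_ 0) := row0_kernel_coords X; rewrite mxE [RHS]mxE [X in _ = _ * X]mxE !eqxx mulr1.
Qed.

Lemma shift_coords00 X : shift_coords X 0 0 = shift_norm X.
Proof.
by have /colP/(_ 0) := col0_shift_coords X; rewrite mxE [RHS]mxE [X in _ = _ * X]mxE !eqxx mulr1.
Qed.

Lemma actB_adj s t : \det (S s) * t = 1 ->
  \adj (S s) = S (\adj (S s) *m delta_mx 0 0)^T.
Proof.
move=> st.
have E : S s *m S (\adj (S s) *m delta_mx 0 0)^T = (\det (S s))%:M.
  by rewrite -actB_mul trmxK mulmxA mul_mx_adj mul_scalar_mx linearZ linearZ /= trmx_delta actB1 scalemx1.
set w := S _ in E *; have := congr1 (mulmx (t *: \adj (S s))) E.
rewrite mulmxA -scalemxAl mul_adj_mx scale_scalar_mx mulrC st mul1mx => ->.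
by rewrite mul_mx_scalar scalerA st scale1r.
Qed.

Local Notation sysmx := (@sysmx R).
Local Notation slice := (@slice R).
Implicit Types (z : 'M[R]_(b, c)) (Z : 'M[R]_(b, m)).

Lemma pairing_row_mx y Z z u : pairing (row_mx y (row_mx Z z)) u =
  pairing (row_mx y (row_mx 0 z)) u + vec_mx (mxvec Z *m sysmx u).
Proof.
rewrite -[sysmx u]/(lin_mx (pairing_mid u)) mul_vec_lin mxvecK /= /pairing_mid.
rewrite -![pairing _ u]/(pairingr u _) -linearD /=.
by rewrite !add_row_mx !addr0 add0r.
Qed.

Lemma pairing_slice u z : pairing (slice u z) u = 0.
Proof.
rewrite /slice; set D := \det _.
rewrite pairing_row_mx vec_mxK -mulmxA mul_adj_mx mul_mx_scalar.
have -> : row_mx (D *: delta_mx 0 0) (row_mx 0 (D *: z)) =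
    D *: row_mx (delta_mx 0 0) (row_mx 0 z) :> 'M_(b, 1 + (m + c)).
  by rewrite !scale_row_mx scaler0.
rewrite -[pairing (_ *: _) u]/(pairingr u _) linearZ /= linearZ linearN /= mxvecK.
by rewrite scalerN subrr.
Qed.

Lemma slice_uniq u Z z : pairing (row_mx (delta_mx 0 0) (row_mx Z z)) u = 0 ->
  slice u z = \det (sysmx u) *: row_mx (delta_mx 0 0) (row_mx Z z).
Proof.
rewrite pairing_row_mx => /eqP; rewrite addrC addr_eq0 => /eqP E.
have E' : - mxvec (pairing (row_mx (delta_mx 0 0) (row_mx 0 z)) u) = mxvec Z *m sysmx u.
  by rewrite -[RHS]vec_mxK E linearN.
rewrite /slice E' -mulmxA mul_mx_adj mul_mx_scalar linearZ /= mxvecK.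
by rewrite !scale_row_mx.
Qed.

Lemma delta1_regmx q :
  (delta_mx 0 0 : 'M[R]_(n, a)) *m P (delta_mx 0 q) = delta_mx 0 q.
Proof.
rewrite -(mul_delta_mx (0 : 'I_1)) -mulmxA mul1_regmx //.
by rewrite mul_delta_mx.
Qed.

(** At the base point the unknown Z is paired with the basis vectors 1, ..., m of
the first copy of A, which [drop_entry] sends to the standard basis. *)
Lemma sysmx1 : sysmx (delta_mx 0 0) = 1%:M.
Proof.
rewrite -[sysmx _]/(lin_mx (pairing_mid (delta_mx 0 0))) -lin_mx_id.
apply: lin_mx_eq => Z /=; rewrite /pairing_mid /pairing big_split_ord /= big1 ?add0r => [|l _].
  rewrite big_split_ord /= [X in _ + X]big1 ?addr0 => [|l _].
    rewrite (eq_bigr (fun i => col i Z *m delta_mx 0 i)) => [|i _].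
      apply/matrixP=> x y; rewrite summxE (bigD1 y) //= big1 ?addr0 => [|i iy].
        by rewrite mxE big_ord1 !mxE !eqxx mulr1.
      by rewrite mxE big_ord1 !mxE [y == i]eq_sym (negbTE iy) mulr0.
    rewrite delta1_regmx drop_entry_shift -(mul_delta_mx (0 : 'I_1)) mulmxA actB_delta trmxK.
    by congr (_ *m _); apply/colP=> x; rewrite mxE row_mxEr row_mxEl [RHS]mxE.
  rewrite (_ : col _ _ = 0) ?trmx0 ?linear0 ?mul0mx //.
  by apply/colP=> x; rewrite mxE row_mxEr row_mxEr !mxE.
rewrite (_ : col _ _ = 0) ?trmx0 ?linear0 ?mul0mx //.
by apply/colP=> x; rewrite mxE row_mxEl !mxE.
Qed.

(** This is why no determinant that occurs below vanishes identically. *)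
Lemma slice1 : slice (delta_mx 0 0) 0 = delta_mx 0 0.
Proof.
have d00 : row_mx (delta_mx 0 0) (row_mx 0 0) = delta_mx 0 0 :> 'M[R]_(b, 1 + (m + c)).
  apply/matrixP=> i j; rewrite !mxE; case: splitP => l /= jl; rewrite mxE.
    by rewrite -[j == 0]val_eqE /= jl ord1.
  by rewrite -[j == 0]val_eqE /= jl andbF; case: splitP => r _; rewrite mxE.
by rewrite (slice_uniq (Z := 0)) ?sysmx1 ?det1 ?scale1r d00 // pairing1 drop_entry1.
Qed.

Lemma kernel_slice u z : u 0 0 = 1 ->
  kernel_vector (slice u z) = kernel_vector (slice u z) 0 0 *: u.
Proof.
move=> u1; rewrite -[LHS]scale1r -u1; apply: kernel_vector_uniq.
exact: pairing_slice.
Qed.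

(** On the slice the normalizations have no effect, up to scalars.  The scalar
[Delta] by which the minors differ from u is invertible exactly where the kernel
is a line. *)
Section OnSlice.
Variables (u : 'M[R]_(n, a)) (z : 'M[R]_(b, c)).
Hypothesis u1 : row 0 u = delta_mx 0 0.
Local Notation X := (slice u z).
Local Notation D := (\det (sysmx u)).
Local Notation Delta := (kernel_vector X 0 0).

Lemma kernel_vector_slice : kernel_vector X = Delta *: u.
Proof. by apply: kernel_slice; have /rowP/(_ 0) := u1; rewrite !mxE. Qed.

Lemma kernel_head_slice : kernel_head X = Delta *: delta_mx 0 0.
Proof. by rewrite -u1 -linearZ /= -kernel_vector_slice. Qed.

Lemma kernel_coords_slice : kernel_coords X = Delta ^+ a *: u.
Proof.
rewrite /kernel_coords kernel_head_slice regmxZ regmx1 // adjZ adj1 -scalemxAr mulmx1.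
by rewrite [X in _ *: X = _]kernel_vector_slice scalerA -exprSr.
Qed.

Lemma shift_slice : shift X = Delta *: X.
Proof. by rewrite /shift kernel_head_slice regmxZ regmx1 // -scalemxAr mulmx1. Qed.

Lemma col0_slice : col 0 X = D *: delta_mx 0 0.
Proof.
apply/colP=> i; rewrite mxE; transitivity (X i (lshift (m + c) 0)).
  by congr (X i _); apply: val_inj.
by rewrite row_mxEl.
Qed.

Lemma actB_shift_head_slice : S (shift_head X) = (Delta * D) *: 1%:M.
Proof.
rewrite /shift_head shift_slice colE -scalemxAl -colE col0_slice scalerA.
rewrite [X in S X](_ : _ = (Delta * D) *: delta_mx 0 0).
  by rewrite linearZ /= actB1.
by apply/rowP=> j; rewrite !mxE eqxx andbT.
Qed.

Lemma shift_coords_slice : shift_coords X = ((Delta * D) ^+ b' * Delta) *: X.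
Proof.
rewrite /shift_coords shift_slice actB_shift_head_slice adjZ adj1.
by rewrite -scalemxAr -scalemxAl mul1mx scalerA mulrC.
Qed.

End OnSlice.

(** A tensor in general position lies in the orbit of the point of the slice with
its normalized coordinates. *)
Section ToSlice.
Variables (X : 'M[R]_(b, a)) (na nb : R).
Hypotheses (nA : kernel_norm X * na = 1) (nB : shift_norm X * nb = 1).
Let u := na *: kernel_coords X.
Let z := nb *: rsubmx (rsubmx (shift_coords X)).
Local Notation D := (\det (sysmx u)).

Lemma row0_coords : row 0 u = delta_mx 0 0.
Proof. by rewrite linearZ /= row0_kernel_coords scalerA mulrC nA scale1r. Qed.

Lemma pairing_shift_coords : pairing (shift_coords X) u = 0.
Proof.
suff E : shift_norm X *: pairing (shift_coords X) u = 0.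
  by rewrite -[LHS]scale1r -nB [_ * nb]mulrC -scalerA E scaler0.
rewrite /shift_norm -mul_scalar_mx -mul_adj_mx -mulmxA -pairing_actB /shift_coords mulmxA mul_mx_adj.
rewrite mul_scalar_mx -[pairing (_ *: _) u]/(pairingr u _) linearZ /= /pairingr pairing_regmx.
rewrite /u -scalemxAl /kernel_coords -mulmxA mul_adj_mx mul_mx_scalar.
by rewrite !linearZ /= pairing_kernel mulmx0 !scaler0.
Qed.

(** The normalized tensor has the form (1 | Z | z) and kills u, and the solution
of the system is unique. *)
Lemma slice_coords : slice u z = (D * nb) *: shift_coords X.
Proof.
have E : nb *: shift_coords X =
    row_mx (delta_mx 0 0) (row_mx (nb *: lsubmx (rsubmx (shift_coords X))) z).
  rewrite -[shift_coords X in LHS](@hsubmxK _ _ 1 (m + c)) scale_row_mx.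
  rewrite -[rsubmx (shift_coords X) in LHS]hsubmxK scale_row_mx; congr row_mx.
  have /(congr1 ( *:%R nb)) := col0_shift_coords X.
  rewrite scalerA mulrC nB scale1r => <-; congr (_ *: _).
  by apply/colP=> i; rewrite mxE [RHS]mxE; congr (shift_coords X _ _); apply: val_inj.
rewrite (slice_uniq (Z := nb *: lsubmx (rsubmx (shift_coords X)))) -E ?scalerA //.
by rewrite -[pairing _ u]/(pairingr u _) linearZ /= /pairingr pairing_shift_coords scaler0.
Qed.

Lemma slice_coords_orbit :
  slice u z = S ((D * nb) *: (\adj (S (shift_head X)) *m delta_mx 0 0)^T)
    *m X *m P (kernel_head X).
Proof.
rewrite slice_coords linearZ /= -(actB_adj nB) -!scalemxAl.
by rewrite -mulmxA.
Qed.

End ToSlice.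

End Theory.

Section Naturality.
Variables (R R' : comAlgType k) (f : {lrmorphism R -> R'}).
Local Notation "M ^f" := (map_mx f M).

Lemma map_actB s : (actB s)^f = actB (s^f).
Proof. by rewrite /actB -map_trmx map_regmx. Qed.

Lemma map_drop_entry u : (drop_entry u)^f = drop_entry (u^f).
Proof.
by apply/matrixP=> i j; rewrite mxE !drop_entryE -map_mxvec [RHS]mxE.
Qed.

Lemma map_pairing X u : (pairing X u)^f = pairing (X^f) (u^f).
Proof.
rewrite /pairing raddf_sum; apply: eq_bigr => l _ /=.
by rewrite map_mxM map_actB -map_trmx map_col map_drop_entry map_mxM map_regmx map_delta_mx.
Qed.

Lemma map_kernel_vector X : (kernel_vector X)^f = kernel_vector (X^f).
Proof.
rewrite /kernel_vector map_vec_mx map_cramer (map_lin_mx (gf := pairing (X^f))) // => u.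
exact: map_pairing.
Qed.

Lemma map_kernel_head X : (kernel_head X)^f = kernel_head (X^f).
Proof. by rewrite /kernel_head map_row map_kernel_vector. Qed.

Lemma map_kernel_coords X : (kernel_coords X)^f = kernel_coords (X^f).
Proof. by rewrite /kernel_coords map_mxM map_mx_adj map_regmx map_kernel_head map_kernel_vector. Qed.

Lemma map_shift X : (shift X)^f = shift (X^f).
Proof. by rewrite /shift map_mxM map_regmx map_kernel_head. Qed.

Lemma map_shift_head X : (shift_head X)^f = shift_head (X^f).
Proof. by rewrite /shift_head -map_trmx map_col map_shift. Qed.

Lemma map_shift_coords X : (shift_coords X)^f = shift_coords (X^f).
Proof. by rewrite /shift_coords map_mxM map_mx_adj map_actB map_shift_head map_shift. Qed.

Lemma map_kernel_norm X : f (kernel_norm X) = kernel_norm (X^f).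
Proof. by rewrite /kernel_norm -det_map_mx map_regmx map_kernel_head. Qed.

Lemma map_sysmx u : (sysmx u)^f = sysmx (u^f).
Proof.
apply: map_lin_mx => Z.
by rewrite map_pairing !map_row_mx !map_mx0.
Qed.

Lemma map_slice u z : (slice u z)^f = slice (u^f) (z^f).
Proof.
rewrite /slice !map_row_mx !map_mxZ map_vec_mx map_mxM map_mxN map_mxvec.
rewrite map_mx_adj map_pairing map_sysmx !map_row_mx !map_mx0 !map_delta_mx.
by rewrite -det_map_mx map_sysmx.
Qed.

End Naturality.

End Slice.

(** * Points of an algebra and of a tensor product in coordinates *)

(** A nonzero vector can be made the first basis vector. *)
Lemma unit_row_basis (k : fieldType) d (v : 'rV[k]_(1 + d)) :
  v != 0 -> exists2 g, g \in unitmx & v *m g = delta_mx 0 0.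
Proof.
move=> v0; have := mulmx_ebase v; rewrite rank_rV v0.
have -> : pid_mx 1 = delta_mx 0 0 :> 'rV[k]_(1 + d).
  by apply/rowP=> j; rewrite !mxE /= andbT eq_sym.
set E := row_ebase v; set c := col_ebase v => vE.
have cu : c \in unitmx by exact: col_ebase_unit.
have c0 : c 0 0 != 0 by rewrite unitmxE det_mx11 unitfE in cu.
exists ((c 0 0)^-1 *: invmx E).
  by rewrite unitmxZ ?unitmx_inv ?row_ebase_unit // unitrV unitfE.
rewrite -vE -scalemxAr mulmxK ?row_ebase_unit // {2}[c]mx11_scalar mul_scalar_mx.
by rewrite scalerA mulVf // scale1r.
Qed.

Section Coordinates.
Variables (k : fieldType) (A : falgType k) (d : nat).
Variables (phi : {linear A -> 'rV[k]_d}) (psi : {linear 'rV[k]_d -> A}).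
Hypotheses (phiK : cancel phi psi) (psiK : cancel psi phi).
Local Notation e := (vbasis {: A}).

(** Multiplication by the i-th basis vector, in the form required by [regmx]. *)
Definition mul_table (i : 'I_d) : 'M[k]_d :=
  \matrix_(j, l) phi (psi (delta_mx 0 j) * psi (delta_mx 0 i)) 0 l.

Definition coords (R : comAlgType k) (x : tensor A R) : 'rV[R]_d :=
  \sum_(i < \dim {: A}) x i *: map_mx (in_alg R) (phi e`_i).

Definition of_coords (R : comAlgType k) (v : 'rV[R]_d) : tensor A R :=
  \sum_i tens (psi (delta_mx 0 i)) (v 0 i).

Section Ring.
Variable R : comAlgType k.
Implicit Types (x y : tensor A R) (v : 'rV[R]_d).

Lemma coordsD x y : coords (x + y) = coords x + coords y.
Proof.
rewrite /coords -big_split; apply: eq_bigr => i _ /=.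
by rewrite ffunE scalerDl.
Qed.

Lemma coords0 : coords 0 = 0 :> 'rV[R]_d.
Proof. by rewrite /coords big1 // => i _; rewrite ffunE scale0r. Qed.

Lemma coords_sum I (r : seq I) (Q : pred I) (F : I -> tensor A R) :
  coords (\sum_(i <- r | Q i) F i) = \sum_(i <- r | Q i) coords (F i).
Proof. exact: (big_morph _ coordsD coords0). Qed.

Lemma coords_tens a r : coords (tens a r) = r *: map_mx (in_alg R) (phi a).
Proof.
rewrite [in RHS](basis_expand a) linear_sum raddf_sum scaler_sumr /coords /=.
apply: eq_bigr => i _; rewrite ffunE linearZ /= map_mxZ scalerA.
by rewrite -[_ *: r]mulr_algl mulrC.
Qed.

Lemma of_coordsK : cancel (@of_coords R) (@coords R).
Proof.
move=> v; rewrite coords_sum [RHS]row_sum_delta; apply: eq_bigr => i _.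
by rewrite coords_tens psiK map_delta_mx.
Qed.

Lemma of_coordsD v w : of_coords (v + w) = of_coords v + of_coords w.
Proof.
rewrite /of_coords -(big_split (R := tensor A R)); apply: eq_bigr => i _ /=.
by rewrite mxE tensDr.
Qed.

Lemma coordsK : cancel (@coords R) (@of_coords R).
Proof.
move=> x; elim/tensor_ind: x => [a r|x y IHx IHy]; last first.
  by rewrite coordsD of_coordsD IHx IHy.
rewrite coords_tens -[in RHS](phiK a) [in RHS](row_sum_delta (phi a)).
rewrite linear_sum tens_suml; apply: eq_bigr => i _.
by rewrite linearZ /= tensZl -tensZr !mxE /= mulr_algr.
Qed.

Lemma coords_mul x y : coords (x * y) = coords x *m regmx mul_table (coords y).
Proof.
elim/tensor_ind: x => [a r|x x' IH IH']; last first.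
  by rewrite mulrDl !coordsD mulmxDl IH IH'.
elim/tensor_ind: y => [a' r'|y y' IH IH']; last first.
  by rewrite mulrDr !coordsD linearD /= mulmxDr IH IH'.
rewrite tens_mul !coords_tens regmxZ -scalemxAl -scalemxAr scalerA; congr (_ *: _).
have -> : regmx mul_table (map_mx (in_alg R) (phi a')) =
   map_mx (in_alg R) (\sum_i phi a' 0 i *: mul_table i).
  rewrite /regmx raddf_sum; apply: eq_bigr => i _.
  by rewrite /= map_mxZ mxE.
rewrite -map_mxM; congr (map_mx _ _).
rewrite -{1}(phiK a') [X in _ * psi X]row_sum_delta linear_sum mulr_sumr.
rewrite linear_sum mulmx_sumr; apply: eq_bigr => i _.
rewrite linearZ /= -scalerAr linearZ -scalemxAr; congr (_ *: _).
rewrite -{1}(phiK a) [X in psi X * _]row_sum_delta linear_sum mulr_suml linear_sum.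
rewrite mulmx_sum_row; apply: eq_bigr => j _.
by rewrite linearZ /= -scalerAl linearZ; congr (_ *: _); apply/rowP=> l; rewrite !mxE.
Qed.

Lemma regmx_inj (M N : 'M[R]_d) :
  (forall x : tensor A R, coords x *m M = coords x *m N) -> M = N.
Proof.
move=> MN; apply/row_matrixP=> i; rewrite !rowE.
by rewrite -[delta_mx 0 i]of_coordsK MN.
Qed.

Lemma regmx_coordsM x y : regmx mul_table (coords (x * y)) =
  regmx mul_table (coords x) *m regmx mul_table (coords y).
Proof. by apply: regmx_inj => z; rewrite mulmxA -!coords_mul mulrA. Qed.

Lemma regmx_coords1 : regmx mul_table (coords (1 : tensor A R)) = 1%:M.
Proof. by apply: regmx_inj => z; rewrite -coords_mul mulr1 mulmx1. Qed.

(** An element is invertible as soon as its norm is: the adjugate, applied to 1,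
gives the inverse. *)
Lemma det_inverse x t : \det (regmx mul_table (coords x)) * t = 1 ->
  {y | y * x = 1}.
Proof.
move=> xt; exists (of_coords (t *: (coords 1 *m \adj (regmx mul_table (coords x))))).
apply: (can_inj coordsK); rewrite coords_mul of_coordsK -scalemxAl -mulmxA.
by rewrite mul_adj_mx mul_mx_scalar scalerA mulrC xt scale1r.
Qed.

End Ring.

Section Naturality.
Variables (R R' : comAlgType k) (f : {lrmorphism R -> R'}).

Lemma coords_map (x : tensor A R) : map_mx f (coords x) = coords (tensor_map f x).
Proof.
rewrite /coords raddf_sum; apply: eq_bigr => i _ /=; rewrite map_mxZ ffunE.
by congr (_ *: _); apply/rowP=> j; rewrite !mxE; exact: rmorph_alg.
Qed.

End Naturality.
End Coordinates.

Lemma mul_tableP (k : fieldType) (A : falgType k) d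
    (phi : {linear A -> 'rV[k]_(1 + d)}) (psi : {linear 'rV[k]_(1 + d) -> A}) :
  cancel phi psi -> cancel psi phi -> phi 1 = delta_mx 0 0 ->
  (forall x y : A, x * y = y * x) -> com_unit_table (mul_table phi psi).
Proof.
move=> phiK psiK phi1 mulC; split=> [|i j|i j].
- apply/row_matrixP=> j; apply/rowP=> l; rewrite row1 !mxE -phi1 phiK mulr1.
  by rewrite psiK !mxE.
- by apply/rowP=> l; rewrite !mxE mulC.
apply/row_matrixP=> p; rewrite row_mul.
have rowE (q r : 'I_(1 + d)) : row q (mul_table phi psi r) =
    phi (psi (delta_mx 0 q) * psi (delta_mx 0 r)).
  by apply/rowP=> l; rewrite !mxE.
rewrite rowE mulmx_sum_row linear_sum.
under eq_bigr => q _ do rewrite rowE.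
under [RHS]eq_bigr => l _ do rewrite linearZ /= rowE.
set x := psi (delta_mx 0 p); set y := psi (delta_mx 0 i); set z := psi _.
have E (u v : A) : \sum_q phi u 0 q *: phi (psi (delta_mx 0 q) * v) = phi (u * v).
  rewrite -[in RHS](phiK u) [in RHS](row_sum_delta (phi u)) linear_sum mulr_suml.
  rewrite linear_sum; apply: eq_bigr => q _.
  by rewrite linearZ /= -scalerAl linearZ.
rewrite [LHS]E.
under eq_bigr => l _ do rewrite mxE -/y -/z [x * _]mulC.
by rewrite [RHS]E [in RHS]mulC mulrA.
Qed.

(** Coordinates in which 1 is the first basis vector, as [com_unit_table] wants. *)
Lemma unit_coordinates (k : fieldType) (A : falgType k) d :
  \dim {: A} = (1 + d)%N ->
  exists (phi : {linear A -> 'rV[k]_(1 + d)}) (psi : {linear 'rV[k]_(1 + d) -> A}),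
    [/\ cancel phi psi, cancel psi phi & phi 1 = delta_mx 0 0].
Proof.
move=> dA; pose e := vbasis {: A}.
pose phi0 (x : A) : 'rV[k]_(1 + d) := \row_i coord e (cast_ord (esym dA) i) x.
pose psi0 (v : 'rV[k]_(1 + d)) : A := \sum_i v 0 i *: e`_i.
have phi0K : cancel phi0 psi0.
  move=> x; rewrite /psi0 [RHS](basis_expand x).
  rewrite [RHS](reindex (cast_ord (esym dA))) /=; last first.
    by exists (cast_ord dA) => i _; rewrite ?cast_ordK ?cast_ordKV.
  by apply: eq_bigr => i _; rewrite mxE.
have psi0K : cancel psi0 phi0.
  move=> v; apply/rowP=> i; rewrite mxE /psi0 (reindex (cast_ord dA)) /=; last first.
    by exists (cast_ord (esym dA)) => j _; rewrite ?cast_ordK ?cast_ordKV.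
  rewrite (coord_sum_free (fun j => v 0 (cast_ord dA j)) _ (basis_free (vbasisP _))).
  by rewrite cast_ordKV.
have [|g gu g1] := @unit_row_basis k d (phi0 1).
  apply/eqP=> p0; have /eqP := phi0K 1; rewrite p0 /psi0 big1 => [|i _].
    by rewrite eq_sym oner_eq0.
  by rewrite mxE scale0r.
have phi_lin : linear (fun x => phi0 x *m g).
  move=> t x y; rewrite scalemxAl -mulmxDl; congr (_ *m _).
  by apply/rowP=> i; rewrite !mxE linearP.
have psi_lin : linear (fun v => psi0 (v *m invmx g)).
  move=> t x y; rewrite mulmxDl -scalemxAl /psi0 scaler_sumr -big_split.
  by apply: eq_bigr => i _; rewrite !mxE scalerDl scalerA.
pose phiL := GRing.isLinear.Build _ _ _ _ _ phi_lin.
pose psiL := GRing.isLinear.Build _ _ _ _ _ psi_lin.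
pose phi : {linear A -> 'rV[k]_(1 + d)} := HB.pack (fun x => phi0 x *m g) phiL.
pose psi : {linear 'rV[k]_(1 + d) -> A} := HB.pack (fun v => psi0 (v *m invmx g)) psiL.
exists phi, psi.
split=> [x|v|] //=; first by rewrite mulmxK.
by rewrite psi0K mulmxKV.
Qed.

Lemma tensor_mulC (k : fieldType) (A : falgType k) (R : algType k) :
  (forall x y : A, x * y = y * x) -> (forall x y : R, x * y = y * x) ->
  forall x y : tensor A R, x * y = y * x.
Proof.
move=> mulA mulR x y; elim/tensor_ind: x => [a r|x x' IH IH']; last first.
  by rewrite mulrDl mulrDr IH IH'.
elim/tensor_ind: y => [a' r'|y y' IH IH']; last first.
  by rewrite mulrDl mulrDr IH IH'.
by rewrite !tens_mul mulA mulR.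
Qed.

Section TensorCoordinates.
Variables (k : fieldType) (A B : falgType k) (a b : nat).
Variables (phiA : {linear A -> 'rV[k]_a}) (psiA : {linear 'rV[k]_a -> A}).
Variables (phiB : {linear B -> 'rV[k]_b}) (psiB : {linear 'rV[k]_b -> B}).
Hypotheses (phiAK : cancel phiA psiA) (psiAK : cancel psiA phiA).
Hypotheses (phiBK : cancel phiB psiB) (psiBK : cancel psiB phiB).
Local Notation C := (tensor A B).

(** Coordinates on A (x) B as b by a matrices, the pure tensor of x and y being
the product of the column of y and the row of x; they are flattened because
[coords] wants row vectors. *)
Definition tphi (x : C) : 'rV[k]_(b * a) :=
  mxvec (\sum_i (phiB (x i))^T *m phiA (vbasis {: A})`_i).

Definition tpsi (v : 'rV[k]_(b * a)) : C :=
  \sum_l tens (psiA (delta_mx 0 l)) (psiB (col l (vec_mx v))^T).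

Fact tphi_is_linear : linear tphi.
Proof.
move=> t x y; rewrite /tphi -linearP; congr mxvec.
rewrite scaler_sumr -big_split; apply: eq_bigr => i _ /=.
by rewrite !ffunE linearP /= linearP /= mulmxDl scalemxAl.
Qed.
HB.instance Definition _ := GRing.isLinear.Build k C _ _ tphi tphi_is_linear.

Fact tpsi_is_linear : linear tpsi.
Proof.
move=> t x y; rewrite /tpsi scaler_sumr -big_split; apply: eq_bigr => i _ /=.
by rewrite !linearP /= tensDr tensZr.
Qed.
HB.instance Definition _ := GRing.isLinear.Build k _ C _ tpsi tpsi_is_linear.

Lemma tphi_tens x y : tphi (tens x y) = mxvec ((phiB y)^T *m phiA x).
Proof.
rewrite /tphi; congr mxvec; rewrite [in RHS](basis_expand x) linear_sum mulmx_sumr.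
apply: eq_bigr => i _; rewrite ffunE linearZ /= linearZ /= -scalemxAl scalemxAr; congr (_ *m _).
by rewrite linearZ.
Qed.

Lemma tpsiK : cancel tpsi tphi.
Proof.
move=> v; rewrite /tpsi linear_sum -[RHS]vec_mxK; set X := vec_mx v.
under eq_bigr => l _ do rewrite /= tphi_tens psiAK psiBK trmxK.
rewrite -linear_sum; congr mxvec; apply/matrixP=> i j.
rewrite summxE (bigD1 j) //= big1 ?addr0 => [|l lj].
  by rewrite mxE big_ord1 !mxE !eqxx mulr1.
by rewrite mxE big_ord1 !mxE [j == l]eq_sym (negbTE lj) mulr0.
Qed.

Lemma tphiK : cancel tphi tpsi.
Proof.
move=> x; elim/tensor_ind: x => [x y|x y IHx IHy]; last by rewrite !linearD /= IHx IHy.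
rewrite tphi_tens /tpsi mxvecK -{2}(phiAK x) [in RHS](row_sum_delta (phiA x)).
rewrite linear_sum tens_suml; apply: eq_bigr => l _.
rewrite linearZ /= tensZl -tensZr; congr tens.
have -> : (col l ((phiB y)^T *m phiA x))^T = phiA x 0 l *: phiB y.
  by apply/rowP=> i; rewrite !mxE big_ord1 !mxE mulrC.
by rewrite linearZ /= phiBK.
Qed.

Section Ring.
Variable R : comAlgType k.
Local Notation coordsA := (@coords k A a phiA R).
Local Notation coordsB := (@coords k B b phiB R).

Definition tcoords (w : tensor C R) : 'M[R]_(b, a) := vec_mx (coords tphi w).
Definition of_tcoords (X : 'M[R]_(b, a)) : tensor C R := of_coords tpsi (mxvec X).

Lemma tcoordsK : cancel tcoords of_tcoords.
Proof. by move=> w; rewrite /of_tcoords vec_mxK (coordsK tphiK). Qed.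

Lemma of_tcoordsK : cancel of_tcoords tcoords.
Proof. by move=> X; rewrite /tcoords (of_coordsK tpsiK) mxvecK. Qed.

(** The scalars of R can be moved into one of the two factors. *)
Lemma tensor_ext_ind (Q : tensor C R -> Prop) :
  (forall x y, Q (tensor_ext x y)) -> (forall u v, Q u -> Q v -> Q (u + v)) ->
  forall w, Q w.
Proof.
move=> Qt QD; elim/tensor_ind=> [x r|]; last exact: QD.
elim/tensor_ind: x => [x y|x y Qx Qy].
  by rewrite -[r]mulr1 -tensor_ext_tens.
suff -> : tens (x + y) r = tens x r + tens y r by apply: QD.
by apply/ffunP=> i; rewrite !ffunE linearD scalerDl.
Qed.

Lemma tcoordsD u v : tcoords (u + v) = tcoords u + tcoords v.
Proof. by rewrite /tcoords coordsD linearD. Qed.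

Lemma tcoords_ext x y : tcoords (tensor_ext x y) = (coordsB y)^T *m coordsA x.
Proof.
elim/tensor_ind: x => [x r|x x' IH IH']; last first.
  by rewrite tensor_extDl tcoordsD coordsD mulmxDr IH IH'.
elim/tensor_ind: y => [y s|y y' IH IH']; last first.
  by rewrite tensor_extDr tcoordsD coordsD linearD mulmxDl IH IH'.
rewrite tensor_ext_tens /tcoords !coords_tens /= tphi_tens map_mxvec linearZ /= mxvecK.
rewrite map_mxM -map_trmx [(_ *: _)^T]linearZ /= -scalemxAl -scalemxAr scalerA.
by rewrite mulrC.
Qed.

Lemma tcoords_mul_ext w x y : tcoords (w * tensor_ext x y) =
  (regmx (mul_table phiB psiB) (coordsB y))^T *m tcoords w
    *m regmx (mul_table phiA psiA) (coordsA x).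
Proof.
elim/tensor_ext_ind: w => [x' y'|u v IHu IHv]; last first.
  by rewrite mulrDl !tcoordsD mulmxDr mulmxDl IHu IHv.
rewrite tensor_extM !tcoords_ext (coords_mul phiAK) (coords_mul phiBK).
by rewrite trmx_mul !mulmxA.
Qed.

Definition tnorm (X : 'M[R]_(b, a)) : R := \det (regmx (mul_table tphi tpsi) (mxvec X)).

Lemma tnormM w w' : tnorm (tcoords (w * w')) = tnorm (tcoords w) * tnorm (tcoords w').
Proof.
by rewrite /tnorm /tcoords !vec_mxK (regmx_coordsM tphiK tpsiK) det_mulmx.
Qed.

Lemma tnorm1 : tnorm (tcoords 1) = 1.
Proof. by rewrite /tnorm /tcoords vec_mxK (regmx_coords1 tphiK tpsiK) det1. Qed.

Lemma tnorm_inverse w t : tnorm (tcoords w) * t = 1 -> {w' | w' * w = 1}.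
Proof. by rewrite /tnorm /tcoords vec_mxK; exact: (det_inverse tphiK tpsiK). Qed.

(** Multiplication by a pure tensor multiplies matrices by y from the left and by
x from the right. *)
Lemma tnorm_ext x y : tnorm (tcoords (tensor_ext x y)) =
  \det (regmx (mul_table phiB psiB) (coordsB y)) ^+ a *
  \det (regmx (mul_table phiA psiA) (coordsA x)) ^+ b.
Proof.
rewrite /tnorm {1}/tcoords vec_mxK.
have -> : regmx (mul_table tphi tpsi) (coords tphi (tensor_ext x y)) =
   lin_mx (mulmx (regmx (mul_table phiB psiB) (coordsB y))^T) *m
   lin_mx (mulmxr (regmx (mul_table phiA psiA) (coordsA x))).
  apply: (regmx_inj tpsiK) => w; rewrite -(coords_mul tphiK).
  rewrite -[coords tphi w]vec_mxK -[coords tphi (w * _)]vec_mxK.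
  rewrite -![vec_mx (coords _ _)]/(tcoords _) tcoords_mul_ext mulmxA mul_vec_lin /=.
  by rewrite mul_vec_lin.
by rewrite det_mulmx det_lin_mulmx det_lin_mulmxr det_tr.
Qed.

End Ring.

Section Naturality.
Variables (R R' : comAlgType k) (f : {lrmorphism R -> R'}).

Lemma tcoords_map (w : tensor C R) : map_mx f (tcoords w) = tcoords (tensor_map f w).
Proof. by rewrite /tcoords map_vec_mx (coords_map tphi). Qed.

Lemma tnorm_map (X : 'M[R]_(b, a)) : f (tnorm X) = tnorm (map_mx f X).
Proof. by rewrite /tnorm -det_map_mx map_regmx map_mxvec. Qed.

End Naturality.
End TensorCoordinates.

(** * Subalgebras given by expressions, and their localizations *)

(** The ring of invariant functions on a group is too large a type to be the
carrier of a k-algebra to which functors of points could be applied.  Once it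
is embedded into a k-algebra F, its image is such a carrier.  A presentation
consists of a type of expressions, of any size, and their values in F; the
values of the expressions form a subalgebra. *)
Record presentation (k : fieldType) (F : comAlgType k) := Presentation {
  expr : Type;
  value :> expr -> F;
  econst : k -> expr;
  eadd : expr -> expr -> expr;
  emul : expr -> expr -> expr;
  valueC : forall c, value (econst c) = c%:A;
  valueD : forall x y, value (eadd x y) = value x + value y;
  valueM : forall x y, value (emul x y) = value x * value y
}.

Section PresentedAlgebra.
Variables (k : fieldType) (F : comAlgType k) (E : presentation F).

Definition presented : {pred F} := fun z => `[< exists x, E x = z >].

Fact presented_closed : subalg_closed presented.
Proof.
split=> [|c u v /asboolP[x <-] /asboolP[y <-]|u v /asboolP[x <-] /asboolP[y <-]].
- by apply/asboolP; exists (econst E 1); rewrite valueC scale1r.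
- apply/asboolP; exists (eadd (emul (econst E c) x) y).
  by rewrite valueD valueM valueC mulr_algl.
- by apply/asboolP; exists (emul x y); rewrite valueM.
Qed.

Record presented_alg := PresentedAlg { pval : F; _ : pval \in presented }.

HB.instance Definition _ := [isSub for pval].
HB.instance Definition _ := [Choice of presented_alg by <:].
HB.instance Definition _ := GRing.SubChoice_isSubAlgebra.Build k F _ presented_alg
  presented_closed.
HB.instance Definition _ := GRing.SubNzRing_isSubComNzRing.Build F _ presented_alg.

Fact pval_is_linear : linear pval. Proof. by []. Qed.
Fact pval_is_monoid_morphism : monoid_morphism pval. Proof. by []. Qed.
HB.instance Definition _ := GRing.isLinear.Build k presented_alg F _ pval pval_is_linear.
HB.instance Definition _ :=
  GRing.isMonoidMorphism.Build presented_alg F pval pval_is_monoid_morphism.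

Fact present_subproof x : E x \in presented.
Proof. by apply/asboolP; exists x. Qed.

Definition present x : presented_alg := PresentedAlg (present_subproof x).

Lemma presented_ex (z : presented_alg) : {x | z = present x}.
Proof.
have [x xz] : {x | E x = val z} by apply/cid; apply/asboolP; exact: (valP z).
by exists x; apply: val_inj.
Qed.

(** A compatible evaluation of the expressions in another algebra R defines a
morphism from the subalgebra, provided that it takes equal values on expressions
with equal value in F.  An expression for a given value is chosen. *)
Section Lift.
Variables (R : comAlgType k) (h : expr E -> R).
Hypotheses (h_eq : forall x y, E x = E y -> h x = h y).
Hypotheses (hC : forall c, h (econst E c) = c%:A).
Hypotheses (hD : forall x y, h (eadd x y) = h x + h y).
Hypotheses (hM : forall x y, h (emul x y) = h x * h y).

Definition lift_fun (z : presented_alg) : R := h (sval (presented_ex z)).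

Lemma lift_funE x : lift_fun (present x) = h x.
Proof.
rewrite /lift_fun; case: presented_ex => y /= xy; apply: h_eq.
by have := congr1 val xy.
Qed.

Fact lift_is_linear : linear lift_fun.
Proof.
move=> c u v; have [[x ->] [y ->]] := (presented_ex u, presented_ex v).
rewrite -[c *: _ + _](_ : present (eadd (emul (econst E c) x) y) = _).
  by rewrite !lift_funE hD hM hC mulr_algl.
by apply: val_inj; rewrite /= valueD valueM valueC mulr_algl.
Qed.

Fact lift_is_monoid_morphism : monoid_morphism lift_fun.
Proof.
split=> [|u v].
  rewrite -[1](_ : present (econst E 1) = _) ?lift_funE ?hC ?scale1r //.
  by apply: val_inj; rewrite /= valueC scale1r.
have [[x ->] [y ->]] := (presented_ex u, presented_ex v).
rewrite -[_ * _](_ : present (emul x y) = _) ?lift_funE ?hM //.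
by apply: val_inj; rewrite /= valueM.
Qed.

Definition lift : {lrmorphism presented_alg -> R} :=
  HB.pack_for {lrmorphism presented_alg -> R} lift_fun
    (GRing.isLinear.Build _ _ _ _ lift_fun lift_is_linear)
    (GRing.isMonoidMorphism.Build _ _ lift_fun lift_is_monoid_morphism).

Lemma liftE x : lift (present x) = h x.
Proof. exact: lift_funE. Qed.

End Lift.
End PresentedAlgebra.

(** For an expression f whose value is invertible in F, with inverse phi, the
subalgebra generated by the values and phi.  An expression is a pair of an
expression u and an exponent i, standing for u / f^i. *)
Section Localization.
Variables (k : fieldType) (F : comAlgType k) (E : presentation F).
Variables (f : expr E) (phi : F).
Hypothesis f_phi : E f * phi = 1.

Fixpoint eexp (x : expr E) i := if i is i'.+1 then emul x (eexp x i') else econst E 1.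

Definition local_value (p : expr E * nat) : F := E p.1 * phi ^+ p.2.
Definition local_add (p q : expr E * nat) :=
  (eadd (emul p.1 (eexp f q.2)) (emul q.1 (eexp f p.2)), (p.2 + q.2)%N).
Definition local_mul (p q : expr E * nat) := (emul p.1 q.1, (p.2 + q.2)%N).

Lemma valueX x i : E (eexp x i) = E x ^+ i.
Proof. by elim: i => [|i IH] /=; rewrite ?valueC ?scale1r // valueM IH exprS. Qed.

Lemma exp_cancel (R : comAlgType k) (y z : R) i : y * z = 1 -> y ^+ i * z ^+ i = 1.
Proof. by move=> yz; rewrite -exprMn yz expr1n. Qed.

Lemma local_sum (R : comAlgType k) (y z u v : R) i j : y * z = 1 ->
  (u * y ^+ j + v * y ^+ i) * z ^+ (i + j) = u * z ^+ i + v * z ^+ j.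
Proof.
move=> yz; rewrite exprD mulrDl; congr (_ + _).
  by rewrite [z ^+ i * _]mulrC mulrA -[u * _ * _]mulrA (exp_cancel _ yz) mulr1.
by rewrite mulrA -[v * _ * _]mulrA (exp_cancel _ yz) mulr1.
Qed.

Fact local_valueC c : local_value (econst E c, 0%N) = c%:A.
Proof. by rewrite /local_value mulr1 valueC. Qed.
Fact local_valueD p q : local_value (local_add p q) = local_value p + local_value q.
Proof. by rewrite /local_value /= valueD !valueM !valueX (local_sum _ _ _ _ f_phi). Qed.
Fact local_valueM p q : local_value (local_mul p q) = local_value p * local_value q.
Proof. by rewrite /local_value /= valueM exprD mulrACA. Qed.

Definition local_pres : presentation F :=
  Presentation local_valueC local_valueD local_valueM.

Definition loc (u : expr E) e : presented_alg local_pres := @present _ _ local_pres (u, e).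

Lemma pval_loc u e : pval (loc u e) = E u * phi ^+ e.
Proof. by []. Qed.

Section LocalLift.
Variables (R : comAlgType k) (h : expr E -> R) (t : R).
Hypotheses (h_eq : forall x y, E x = E y -> h x = h y).
Hypotheses (hC : forall c, h (econst E c) = c%:A).
Hypotheses (hD : forall x y, h (eadd x y) = h x + h y).
Hypotheses (hM : forall x y, h (emul x y) = h x * h y).
Hypothesis ht : h f * t = 1.

Definition local_ev (p : expr E * nat) : R := h p.1 * t ^+ p.2.

Fact local_evX x i : h (eexp x i) = h x ^+ i.
Proof. by elim: i => [|i IH] /=; rewrite ?hC ?scale1r // hM IH exprS. Qed.

(** If u / f^i = v / f^j in F then u f^j = v f^i, an equation between values of
the original expressions, which are evaluated in R consistently. *)
Fact local_ev_eq p q : local_value p = local_value q -> local_ev p = local_ev q.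
Proof.
case: p q => [u i] [v j]; rewrite /local_value /local_ev /= => uv.
have : h (emul u (eexp f j)) = h (emul v (eexp f i)).
  apply: h_eq; rewrite !valueM !valueX.
  rewrite -[E u]mulr1 -(exp_cancel i f_phi) [E f ^+ i * _]mulrC mulrA uv.
  by rewrite mulrAC -[_ * phi ^+ j * _]mulrA [phi ^+ j * _]mulrC (exp_cancel j f_phi) mulr1.
rewrite !hM !local_evX => huv.
rewrite -[h u]mulr1 -(exp_cancel j ht) mulrA huv.
by rewrite mulrAC -[_ * _ * t ^+ i]mulrA (exp_cancel i ht) mulr1.
Qed.

Fact local_evC c : local_ev (econst E c, 0%N) = c%:A.
Proof. by rewrite /local_ev hC mulr1. Qed.
Fact local_evD p q : local_ev (local_add p q) = local_ev p + local_ev q.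
Proof. by rewrite /local_ev /= hD !hM !local_evX (local_sum _ _ _ _ ht). Qed.
Fact local_evM p q : local_ev (local_mul p q) = local_ev p * local_ev q.
Proof. by rewrite /local_ev /= hM exprD mulrACA. Qed.

Definition local_lift : {lrmorphism presented_alg local_pres -> R} :=
  @lift k F local_pres R local_ev local_ev_eq local_evC local_evD local_evM.

Lemma local_liftE u e : local_lift (loc u e) = h u * t ^+ e.
Proof. exact: liftE. Qed.

End LocalLift.
End Localization.

(** * Rational functions *)

Section RationalFunctions.
Variables (k : fieldType) (n : nat).

Local Notation "x %:F" := (FracField.tofrac x).
(** The name hides the fraction field, so that the structure of a k-algebra can be
added to that of a field. *)
Definition ratfun : Type := {fraction {mpoly k[n]}}.
HB.instance Definition _ := GRing.Field.on ratfun.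
Definition rat_scale (c : k) (x : ratfun) : ratfun := (c%:MP)%:F * x.

Fact rat_scaleA a b v : rat_scale a (rat_scale b v) = rat_scale (a * b) v.
Proof. by rewrite /rat_scale mulrA -rmorphM -mpolyCM. Qed.
Fact rat_scale1 : left_id 1 rat_scale.
Proof. by move=> v; rewrite /rat_scale mpolyC1 rmorph1 mul1r. Qed.
Fact rat_scaleDr : right_distributive rat_scale +%R.
Proof. by move=> c u v; rewrite /rat_scale mulrDr. Qed.
Fact rat_scaleDl v : {morph rat_scale^~ v : a b / a + b}.
Proof. by move=> a b; rewrite /rat_scale mpolyCD rmorphD mulrDl. Qed.
HB.instance Definition _ := GRing.Zmodule_isLmodule.Build k ratfun
  rat_scaleA rat_scale1 rat_scaleDr rat_scaleDl.
Fact rat_scaleAl (c : k) (x y : ratfun) : c *: (x * y) = (c *: x) * y.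
Proof. exact: mulrA. Qed.
HB.instance Definition _ := GRing.Lmodule_isLalgebra.Build k ratfun rat_scaleAl.
HB.instance Definition _ := GRing.Lalgebra_isComAlgebra.Build k ratfun.

Definition to_ratfun (p : {mpoly k[n]}) : ratfun := p%:F.
Fact to_ratfun_is_linear : linear to_ratfun.
Proof. by move=> c p q; rewrite /to_ratfun rmorphD -mul_mpolyC rmorphM. Qed.
Fact to_ratfun_is_monoid_morphism : monoid_morphism to_ratfun.
Proof. by split=> [|p q]; rewrite /to_ratfun ?rmorph1 ?rmorphM. Qed.
HB.instance Definition _ :=
  GRing.isLinear.Build k {mpoly k[n]} ratfun _ to_ratfun to_ratfun_is_linear.
HB.instance Definition _ := GRing.isMonoidMorphism.Build {mpoly k[n]} ratfun
  to_ratfun to_ratfun_is_monoid_morphism.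

Lemma to_ratfun_eq0 p : (to_ratfun p == 0) = (p == 0).
Proof. exact: tofrac_eq0. Qed.

Lemma to_ratfun_inj : injective to_ratfun.
Proof. by move=> p q /eqP; rewrite /to_ratfun tofrac_eq => /eqP. Qed.

(** The generic point of affine space. *)
Definition poly_point : 'rV[{mpoly k[n]}]_n := \row_i 'X_i.

Section Evaluation.
Variables (R : comAlgType k) (v : 'rV[R]_n).

Definition poly_ev (p : {mpoly k[n]}) : R := mmap (in_alg R) (v 0) p.
Fact poly_ev_is_linear : linear poly_ev.
Proof. by move=> c p q; rewrite /poly_ev mmapD mmapZ /= mulr_algl. Qed.
Fact poly_ev_is_monoid_morphism : monoid_morphism poly_ev.
Proof. by split=> [|p q]; rewrite /poly_ev ?rmorph1 ?rmorphM. Qed.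
HB.instance Definition _ :=
  GRing.isLinear.Build k {mpoly k[n]} R _ poly_ev poly_ev_is_linear.
HB.instance Definition _ := GRing.isMonoidMorphism.Build {mpoly k[n]} R
  poly_ev poly_ev_is_monoid_morphism.

Lemma poly_ev_point : map_mx poly_ev poly_point = v.
Proof. by apply/rowP=> i; rewrite !mxE /poly_ev mmapX mmap1U. Qed.

End Evaluation.

End RationalFunctions.

(** A regular function on affine space is a polynomial, namely its own value at
the generic point, and polynomials over a field have no zero divisors. *)
Lemma affine_space_nzd (k : fieldType) N (g : regfun (affine_space k N))
    (R : comAlgType k) (v : 'rV[R]_N) :
  g R v != 0 -> non_zero_divisor g.
Proof.
have E (f : regfun (affine_space k N)) (S : comAlgType k) (x : 'rV[S]_N) :
    f S x = poly_ev x (f _ (poly_point k N)).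
  by rewrite -rf_nat /= poly_ev_point.
move=> gv c gc S x; have /eqP := gc _ (poly_point k N).
rewrite mulf_eq0 => /orP[/eqP g0|/eqP c0]; last by rewrite E c0 rmorph0.
by case/negP: gv; rewrite E g0 rmorph0.
Qed.

(** * Birationality of a quotient with an affine space, from a slice *)

Lemma inverse_uniq (R : comNzRingType) (x y z : R) : x * y = 1 -> x * z = 1 -> y = z.
Proof. by move=> xy xz; rewrite -[y]mulr1 -xz mulrA [y * x]mulrC xy mul1r. Qed.

Section Quotient.
Variables (k : fieldType) (G : kgroup k) (H : forall R : comAlgType k, G R -> Prop).
Local Notation invfun := (invfun H).
Local Notation Q := (Defs.quotient_group H).

Lemma invfun_ext (u v : invfun) :
  (forall (R : comAlgType k) (x : G R), u R x = v R x) -> u = v.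
Proof.
case: u v => [[u un] ui] [[v vn] vi] /= uv.
have E : u = v by apply: functional_extensionality_dep => R; apply: funext; exact: uv.
subst v; have En : un = vn by exact: Prop_irrelevance.
by subst vn; congr InvFun; exact: Prop_irrelevance.
Qed.

Fact quotient_fun_nat (u : invfun) (R S : comAlgType k) (f : {lrmorphism R -> S})
  (x : Q R) : (fmap Q f x : quotient_pts H S) u = f ((x : quotient_pts H R) u).
Proof. by []. Qed.

Definition quotient_fun (u : invfun) : regfun Q :=
  @RegFun k Q (fun R (x : quotient_pts H R) => x u) (quotient_fun_nat u).

(** A point w of G in an algebra F is generic when a regular function that
vanishes at w vanishes.  Evaluation at w then embeds the ring of invariants of H
into F. *)
Section Generic.
Variables (F : comAlgType k) (w : G F).
Hypothesis generic : forall u : regfun G, u F w = 0 ->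
  forall (R : comAlgType k) (x : G R), u R x = 0.

Lemma invfun_generic (u v : invfun) : u F w = v F w -> u = v.
Proof.
move=> uv; apply: invfun_ext => R x; apply/eqP; rewrite -subr_eq0; apply/eqP.
have := @generic (inv_add u (inv_mul (inv_const H (-1)) v)); rewrite /= => /(_ _ R x).
by rewrite !scaleN1r !mulN1r; apply; rewrite uv subrr.
Qed.

Definition inv_pres : presentation F :=
  @Presentation k F invfun (fun u => u F w) (@inv_const k G H) (@inv_add k G H)
    (@inv_mul k G H) (fun _ => erefl) (fun _ _ => erefl) (fun _ _ => erefl).

Definition quotient_lift (R : comAlgType k) (x : quotient_pts H R) :
    {lrmorphism presented_alg inv_pres -> R} :=
  @lift k F inv_pres R x (fun u v uv => congr1 x (invfun_generic uv))
    (qevC x) (qevD x) (qevM x).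

(** A function c on the quotient is determined by its value c(xI) at the
tautological point xI, the one with values in the image of the ring of
invariants in F.  If f c = 0 then f(w) c(xI) = 0 in F, where f(w) is
invertible. *)
Lemma quotient_fun_nzd (f : invfun) (phi : F) : f F w * phi = 1 ->
  non_zero_divisor (quotient_fun f).
Proof.
move=> f_phi c fc R x.
have presentC (d : k) : @present _ _ inv_pres (inv_const H d) = d%:A by exact: val_inj.
have presentD (u v : invfun) : @present _ _ inv_pres (inv_add u v) =
  @present _ _ inv_pres u + @present _ _ inv_pres v by exact: val_inj.
have presentM (u v : invfun) : @present _ _ inv_pres (inv_mul u v) =
  @present _ _ inv_pres u * @present _ _ inv_pres v by exact: val_inj.
pose xI : Q (presented_alg inv_pres) :=
  @QuotientPt k G H _ (@present _ _ inv_pres) presentC presentD presentM.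
have -> : x = fmap Q (quotient_lift x) xI.
  apply: quotient_pts_inj => u.
  by rewrite -[RHS]/(quotient_lift x (@present _ _ inv_pres u)) liftE.
rewrite rf_nat.
suff -> : c (presented_alg inv_pres) xI = 0 by rewrite rmorph0.
have := congr1 val (fc _ xI); rewrite /=.
set z := c _ xI => fz; apply: val_inj; rewrite /=.
by rewrite -[LHS]mul1r -[X in X * _]f_phi mulrAC fz mul0r.
Qed.

(** The map s is a candidate for a section of the projection from G to its
quotient, over the open subset where f is invertible, and defined where g is;
the functions q / f are candidates for the inverse of the composite of s and
the projection.  That q / f recovers the coordinates of a point y from s(y) is
[q_slice].  For the other composite, let y0 be the value of q / f at the generic
point w: by [slice_generic], s(y0) and w are not separated by invariant
functions, and as identities between invariants can be checked at w, that is
enough.  [g_generic] says that g (q / f) is invertible in the ring of invariants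
localized at f, and not only in F. *)
Section Criterion.
Variables (N : nat) (g : regfun (affine_space k N)) (s : kmap (principal_open g) G).
Variables (f : invfun) (phi : F) (q : 'I_N -> invfun) (y0 : 'rV[F]_N).
Hypothesis g_nzd : non_zero_divisor g.
Hypothesis f_phi : f F w * phi = 1.
Hypothesis f_unit : forall (R : comAlgType k) (y : principal_open g R),
  exists t, f R (s R y) * t = 1.
Hypothesis q_slice : forall (R : comAlgType k) (y : principal_open g R) i,
  q i R (s R y) = f R (s R y) * (sval y).1 0 i.
Hypothesis q_generic : forall i, q i F w = f F w * y0 0 i.
Hypothesis g_generic : exists (u : invfun) (e : nat), g F y0 * (u F w * phi ^+ e) = 1.
Hypothesis slice_generic : forall y : principal_open g F, (sval y).1 = y0 ->
  forall u : invfun, u F (s F y) = u F w.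

(* J is the localization at f of the ring of invariants, in F, and the
   morphisms from J to R are the R-points of the open subset of the quotient
   where f is invertible. *)
Let f_phi' : inv_pres f * phi = 1 := f_phi.
Local Notation EJ := (local_pres f_phi').
Local Notation J := (presented_alg EJ).

Definition open_lift (R : comAlgType k) (x : quotient_pts H R) (t : R)
    (xt : x f * t = 1) : {lrmorphism J -> R} :=
  local_lift (E := inv_pres) f_phi' (fun u v uv => congr1 x (invfun_generic uv))
    (qevC x) (qevD x) (qevM x) xt.

Lemma open_liftE (R : comAlgType k) (x : quotient_pts H R) (t : R)
    (xt : x f * t = 1) u e : open_lift xt (loc f_phi' u e) = x u * t ^+ e.
Proof. exact: local_liftE. Qed.
Local Notation X := (principal_open (quotient_fun f)).
Local Notation Y := (principal_open g).

(* The universal point of the slice; to_slice specializes it. *)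
Let yJ : 'rV[J]_N := \row_i loc f_phi' (q i) 1.

Fact pval_yJ : map_mx (@pval _ _ EJ) yJ = y0.
Proof.
apply/rowP=> i; rewrite !mxE /= /local_value /= q_generic expr1.
by rewrite mulrAC f_phi mul1r.
Qed.

Fact g_yJ_unit : exists t : J, g J yJ * t = 1.
Proof.
have [u [e ge]] := g_generic; exists (loc f_phi' u e); apply: val_inj => /=.
by rewrite -ge -pval_yJ -(rf_nat g (@pval _ _ EJ)).
Qed.

Let tJ := sval (cid g_yJ_unit).
Fact point_subproof : g J yJ * tJ == 1.
Proof. by apply/eqP; exact: svalP (cid g_yJ_unit). Qed.
Let pJ : Y J := exist _ (yJ, tJ) point_subproof.

Definition to_slice R (p : X R) : Y R :=
  fmap Y (open_lift (eqP (svalP p))) pJ.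

Fact to_slice_nat (R S : comAlgType k) (h : {lrmorphism R -> S}) (p : X R) :
  to_slice (fmap X h p) = fmap Y h (to_slice p).
Proof.
have E z : open_lift (eqP (svalP (fmap X h p))) z =
    h (open_lift (eqP (svalP p)) z).
  have [[u e] ->] := presented_ex z.
  by rewrite !open_liftE rmorphM rmorphXn.
apply: principal_open_inj; congr pair; last exact: E.
by apply/rowP=> i; rewrite [LHS]mxE [RHS]mxE E !mxE.
Qed.

Let tf (R : comAlgType k) (y : Y R) : R := sval (cid (f_unit y)).
Fact tfP (R : comAlgType k) (y : Y R) : f R (s R y) * tf y = 1.
Proof. exact: svalP (cid (f_unit y)). Qed.

Definition from_slice R (y : Y R) : X R :=
  exist _ (quotient_proj H R (s R y), tf y) (introT eqP (tfP y)).

Lemma quotient_open_inj (R : comAlgType k) (p p' : X R) :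
  (forall u : invfun, ((sval p).1 : quotient_pts H R) u =
                      ((sval p').1 : quotient_pts H R) u) -> p = p'.
Proof.
move=> pp; have E : (sval p).1 = (sval p').1 by exact: quotient_pts_inj.
have := eqP (svalP p); have := eqP (svalP p'); rewrite E => p't pt.
apply: principal_open_inj.
rewrite [sval p]surjective_pairing [sval p']surjective_pairing E.
by congr pair; exact: inverse_uniq pt p't.
Qed.

(** A point of a principal open subset is determined by its first component,
   the second one being an inverse. *)
Lemma slice_open_inj (R : comAlgType k) (y y' : Y R) :
  (sval y).1 = (sval y').1 -> y = y'.
Proof.
move=> E; have := eqP (svalP y); have := eqP (svalP y'); rewrite E => y't yt.
apply: principal_open_inj.
rewrite [sval y]surjective_pairing [sval y']surjective_pairing E.
by congr pair; exact: inverse_uniq yt y't.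
Qed.

Lemma birational_of_slice : birational Q (affine_space k N).
Proof.
exists (quotient_fun f), g; split=> //; first exact: quotient_fun_nzd f_phi.
exists (KMap to_slice_nat) => R; exists (@from_slice R) => [p|y].
  apply: quotient_open_inj => u.
  rewrite -[LHS]/(u R (s R (fmap Y (open_lift (eqP (svalP p))) pJ))).
  rewrite kmap_nat rf_nat.
  have -> : u J (s J pJ) = loc f_phi' u 0.
    apply: val_inj.
    rewrite -[LHS]/(@pval _ _ EJ _) -rf_nat -kmap_nat.
    rewrite slice_generic /= ?pval_yJ //.
    by rewrite /local_value /= mulr1.
  by rewrite open_liftE mulr1.
apply: slice_open_inj; apply/rowP=> i.
rewrite [LHS]mxE [X in open_lift _ X]mxE open_liftE /= expr1 q_slice.
by rewrite mulrAC tfP mul1r.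
Qed.

End Criterion.
End Generic.
End Quotient.

(** * The generic unit of a tensor product *)

Section TensorUnits.
Variables (k : fieldType) (A B : falgType k) (a b : nat).
Variables (phiA : {linear A -> 'rV[k]_a}) (psiA : {linear 'rV[k]_a -> A}).
Variables (phiB : {linear B -> 'rV[k]_b}) (psiB : {linear 'rV[k]_b -> B}).
Hypotheses (phiAK : cancel phiA psiA) (psiAK : cancel psiA phiA).
Hypotheses (phiBK : cancel phiB psiB) (psiBK : cancel psiB phiB).
Hypotheses (mulAC : forall x y : A, x * y = y * x).
Hypotheses (mulBC : forall x y : B, x * y = y * x).
Local Notation C := (tensor A B).
Local Notation G := (GL1 C).
Local Notation norm := (tnorm phiA psiA phiB psiB).

Definition xmat (R : comAlgType k) (w : G R) : 'M[R]_(b, a) := tcoords phiA phiB (uval w).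

Lemma xmat_inj (R : comAlgType k) : injective (@xmat R).
Proof.
move=> v w vw; apply: units_inj.
by apply: (can_inj (tcoordsK phiAK phiBK (R := R))); exact: vw.
Qed.

Lemma xmat_map (R R' : comAlgType k) (f : {lrmorphism R -> R'}) (w : G R) :
  xmat (fmap G f w) = map_mx f (xmat w).
Proof. by rewrite /xmat tcoords_map. Qed.

Definition unit_norm_inv (R : comAlgType k) (w : G R) : R :=
  norm (tcoords phiA phiB (uinv w)).

Lemma unit_norm_invP (R : comAlgType k) (w : G R) : norm (xmat w) * unit_norm_inv w = 1.
Proof.
rewrite /xmat /unit_norm_inv -(tnormM phiAK psiAK phiBK psiBK) uvalV.
exact: (tnorm1 phiAK psiAK phiBK psiBK).
Qed.

Lemma unit_norm_inv_map (R R' : comAlgType k) (f : {lrmorphism R -> R'}) (w : G R) :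
  unit_norm_inv (fmap G f w) = f (unit_norm_inv w).
Proof. by rewrite /unit_norm_inv tnorm_map tcoords_map. Qed.

Lemma ex_unit_of_norm (R : comAlgType k) (X : 'M[R]_(b, a)) t :
  norm X * t = 1 -> {w : G R | xmat w = X}.
Proof.
pose w := of_tcoords psiA psiB X.
have wX : tcoords phiA phiB w = X by exact: of_tcoordsK.
rewrite -wX => /(tnorm_inverse phiAK psiAK phiBK psiBK)[w' w'w].
have ww' : w * w' = 1.
  by rewrite (tensor_mulC (tensor_mulC mulAC mulBC)) // => x y; exact: mulrC.
by exists (unit_of ww' w'w).
Qed.

(* Xp is the generic tensor, and d the polynomial that is its norm.  The generic
   unit is the generic tensor over the polynomial ring with d inverted. *)
Let n := (b * a)%N.
Let Xp : 'M[{mpoly k[n]}]_(b, a) := vec_mx (poly_point k n).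
Let d : {mpoly k[n]} := norm Xp.

(** The tensor 1 has norm 1. *)
Lemma norm_poly_neq0 : d != 0.
Proof.
apply/eqP=> d0.
have := tnorm1 phiAK psiAK phiBK psiBK (ratfun k n).
set X := tcoords _ _ _ => X1.
have : norm (map_mx (poly_ev (mxvec X)) Xp) = 1 :> ratfun k n.
  by rewrite /Xp map_vec_mx poly_ev_point mxvecK.
by rewrite -tnorm_map -/d d0 rmorph0 => /eqP; rewrite eq_sym oner_eq0.
Qed.

Fact poly_valueC (c : k) : to_ratfun (c%:A : {mpoly k[n]}) = c%:A.
Proof. exact: rmorph_alg. Qed.

Definition poly_pres : presentation (ratfun k n) :=
  @Presentation k (ratfun k n) {mpoly k[n]} (@to_ratfun k n) (fun c => c%:A)
   +%R *%R poly_valueC (rmorphD (@to_ratfun k n)) (rmorphM (@to_ratfun k n)).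

Fact norm_poly_inv : poly_pres d * (to_ratfun d)^-1 = 1.
Proof. by rewrite divff // to_ratfun_eq0 norm_poly_neq0. Qed.

Local Notation EU := (local_pres norm_poly_inv).
Local Notation U := (presented_alg EU).

Let XU : 'M[U]_(b, a) := map_mx (fun p : {mpoly k[n]} => loc norm_poly_inv p 0) Xp.

Fact pval_XU : map_mx (@pval _ _ EU) XU = map_mx (@to_ratfun k n) Xp.
Proof. by apply/matrixP=> i j; rewrite [RHS]mxE mxE mxE pval_loc mulr1. Qed.

Fact norm_XU : norm XU * loc norm_poly_inv (1 : {mpoly k[n]}) 1 = 1.
Proof.
have E : @pval _ _ EU (norm XU) = to_ratfun d.
  by rewrite tnorm_map pval_XU /d [RHS]tnorm_map.
apply: val_inj; rewrite -[LHS]/(@pval _ _ EU _) rmorphM /= E.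
by rewrite /local_value /= rmorph1 mul1r expr1; exact: norm_poly_inv.
Qed.

Let wU : G U := sval (ex_unit_of_norm norm_XU).
Definition generic_unit : G (ratfun k n) := fmap G (@pval _ _ EU) wU.

(** Every unit x is a specialization of the generic one: the coordinates of x
define a morphism from the polynomial ring, which extends to the localization
because the norm of x is invertible. *)
Lemma generic_unitP (u : regfun G) : u _ generic_unit = 0 ->
  forall (R : comAlgType k) (x : G R), u R x = 0.
Proof.
rewrite /generic_unit rf_nat => uU R x.
have {}uU : u U wU = 0 by exact: val_inj.
have h_eq (p q : {mpoly k[n]}) : poly_pres p = poly_pres q ->
    poly_ev (mxvec (xmat x)) p = poly_ev (mxvec (xmat x)) q.
  by move/to_ratfun_inj ->.
have hd : poly_ev (mxvec (xmat x)) d * unit_norm_inv x = 1.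
  by rewrite /d tnorm_map /Xp map_vec_mx poly_ev_point mxvecK unit_norm_invP.
pose h := local_lift norm_poly_inv h_eq (rmorph_alg _) (rmorphD _) (rmorphM _) hd.
suff -> : x = fmap G h wU by rewrite rf_nat uU rmorph0.
apply: xmat_inj; rewrite xmat_map /wU (svalP (ex_unit_of_norm norm_XU)).
rewrite -[LHS]mxvecK -[mxvec _](poly_ev_point (mxvec (xmat x))) -map_vec_mx.
apply/matrixP=> i j; rewrite [RHS]mxE [XU _ _]mxE local_liftE mulr1.
by rewrite mxE.
Qed.

End TensorUnits.

(** * The quotient of the units of a tensor product by the pure tensors *)

(** The identity that shows that the determinant of the slice is invertible at the
normalized coordinates of a tensor of norm N.  The norms of the two factors that
move the tensor to the slice are dP and dS, and (n, a, b, m) are related so that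
the powers of N and of its inverse t cancel. *)
Lemma weights_cancel (R : comNzRingType) (N t D Di nA iA nB iB : R) (a m b n : nat) :
  N * t = 1 -> D * Di = 1 -> nA * iA = 1 -> nB * iB = 1 ->
  (n * (a + m) = 1 + m * (b + n))%N ->
  let dS := D ^+ b * (t ^+ n * iB) in let dP := nA * N ^+ m in
  N * (dS ^+ a * dP ^+ b) * (dS ^+ m * dP ^+ n * D) *
    (nB ^+ (a + m) * Di ^+ (b * (a + m)).+1 * iA ^+ (b + n)) = 1.
Proof.
move=> Nt DDi Ai Bi en dS dP.
have -> : N * (dS ^+ a * dP ^+ b) * (dS ^+ m * dP ^+ n * D) =
    N * D * (dS ^+ (a + m) * dP ^+ (b + n)).
  by rewrite !exprD [_ * D]mulrC mulrACA; congr (_ * _); rewrite mulrACA.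
rewrite /dS /dP !exprMn -!exprM en; set M := (b * (a + m))%N; set L := (b + n)%N.
set K := (a + m)%N; set J := (m * L)%N.
have E1 : N * N ^+ J * t ^+ (1 + J) = 1 by rewrite -exprS -exprMn Nt expr1n.
have E2 : D * D ^+ M * Di ^+ M.+1 = 1 by rewrite -exprS -exprMn DDi expr1n.
have E3 : nA ^+ L * iA ^+ L = 1 by rewrite -exprMn Ai expr1n.
have E4 : nB ^+ K * iB ^+ K = 1 by rewrite -exprMn Bi expr1n.
transitivity (N * N ^+ J * t ^+ (1 + J) * (D * D ^+ M * Di ^+ M.+1)
    * (nA ^+ L * iA ^+ L) * (nB ^+ K * iB ^+ K)); last by rewrite E1 E2 E3 E4 !mulr1.
move: (t ^+ _) (Di ^+ _) (D ^+ _) (N ^+ _) (nA ^+ _) (iA ^+ _) (nB ^+ _) (iB ^+ _).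
by move=> t' Di' D' N' nA' iA' nB' iB'; ring.
Qed.

Section TensorQuotient.
Variables (k : fieldType) (A B : falgType k) (m c n' b' : nat).
Local Notation a := (1 + (m + c))%N.
Local Notation n := (1 + n')%N.
Local Notation b := (1 + b')%N.
Hypothesis e : (n * a = 1 + b * m)%N.
Hypotheses (mulAC : forall x y : A, x * y = y * x).
Hypotheses (mulBC : forall x y : B, x * y = y * x).
Variables (phiA : {linear A -> 'rV[k]_a}) (psiA : {linear 'rV[k]_a -> A}).
Variables (phiB : {linear B -> 'rV[k]_b}) (psiB : {linear 'rV[k]_b -> B}).
Hypotheses (phiAK : cancel phiA psiA) (psiAK : cancel psiA phiA).
Hypotheses (phiBK : cancel phiB psiB) (psiBK : cancel psiB phiB).
Hypotheses (phiA1 : phiA 1 = delta_mx 0 0) (phiB1 : phiB 1 = delta_mx 0 0).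

Local Notation C := (tensor A B).
Local Notation G := (GL1 C).
Local Notation H := (image_pts (tensor_hom A B)).
Local Notation rhoA := (mul_table phiA psiA).
Local Notation rhoB := (mul_table phiB psiB).
Local Notation P := (regmx rhoA).
Local Notation S := (actB rhoB).
Local Notation kernel_coords := (kernel_coords rhoA rhoB e).
Local Notation shift_coords := (shift_coords rhoA rhoB e).
Local Notation kernel_vector := (kernel_vector rhoA rhoB e).
Local Notation sysmx := (sysmx rhoA rhoB e).
Local Notation slice := (slice rhoA rhoB e).
Local Notation kernel_norm := (kernel_norm rhoA rhoB e).
Local Notation shift_norm := (shift_norm rhoA rhoB e).
Local Notation kernel_head := (kernel_head rhoA rhoB e).
Local Notation shift_head := (shift_head rhoA rhoB e).
Local Notation shift := (shift rhoA rhoB e).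
Local Notation xmat := (xmat phiA phiB).
Local Notation norm := (tnorm phiA psiA phiB psiB).
Local Notation norm_inv := (unit_norm_inv phiA psiA phiB psiB).

Let rhoAP : com_unit_table rhoA := mul_tableP phiAK psiAK phiA1 mulAC.
Let rhoBP : com_unit_table rhoB := mul_tableP phiBK psiBK phiB1 mulBC.

Section Points.
Variable R : comAlgType k.

Lemma coords1A : coords phiA (1 : tensor A R) = delta_mx 0 0.
Proof. by rewrite [LHS]coords_tens phiA1 scale1r map_delta_mx. Qed.

Lemma coords1B : coords phiB (1 : tensor B R) = delta_mx 0 0.
Proof. by rewrite [LHS]coords_tens phiB1 scale1r map_delta_mx. Qed.

Lemma xmat1 : xmat (1%g : gpts G R) = delta_mx 0 0.
Proof.
rewrite /xmat -[uval _]/(1 : tensor C R) -tensor_ext1 tcoords_ext coords1A coords1B.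
by rewrite trmx_delta mul_delta_mx.
Qed.

Lemma norm_delta : norm (delta_mx 0 0) = 1 :> R.
Proof. by rewrite -xmat1; exact: (tnorm1 phiAK psiAK phiBK psiBK). Qed.

Lemma xmat_mul_ext (w h : gpts G R) x y : uval h = tensor_ext x y ->
  xmat (w * h)%g = S (coords phiB y) *m xmat w *m P (coords phiA x).
Proof.
move=> hxy; rewrite /xmat -[uval (w * h)%g]/(uval w * uval h) hxy.
exact: tcoords_mul_ext.
Qed.

End Points.

Lemma regmx_inverse (R : comAlgType k) (x y : tensor A R) : x * y = 1 ->
  P (coords phiA x) *m P (coords phiA y) = 1%:M.
Proof.
move=> xy; rewrite -(regmx_coordsM phiAK psiAK) xy.
exact: (regmx_coords1 phiAK psiAK).
Qed.

Fact image_norm_nat (R R' : comAlgType k) (f : {lrmorphism R -> R'}) (w : G R) :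
  kernel_norm (xmat (fmap G f w)) - norm (xmat (fmap G f w)) ^+ m =
  f (kernel_norm (xmat w) - norm (xmat w) ^+ m).
Proof. by rewrite xmat_map -map_kernel_norm -tnorm_map rmorphB rmorphXn. Qed.

Fact image_shift_nat i j (R R' : comAlgType k) (f : {lrmorphism R -> R'}) (w : G R) :
  shift (xmat (fmap G f w)) i (rshift 1 j) = f (shift (xmat w) i (rshift 1 j)).
Proof. by rewrite xmat_map -map_shift mxE. Qed.

Lemma kernel_head1 (R : comAlgType k) : kernel_head (delta_mx 0 0) = delta_mx 0 0 :> 'rV[R]_a.
Proof. by rewrite /kernel_head kernel_vector1 //; apply/rowP=> j; rewrite !mxE eqxx. Qed.

(** A pure tensor x (x) y has kernel vector (x^(-1), 0, ..., 0), up to a scalar.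
So the norm of its first entry is a power of the norm of the tensor, and the
shifted tensor lies in 1 (x) B. *)
Lemma tensor_hom_equations (R : comAlgType k) (p : kprod (GL1 A) (GL1 B) R) :
  let X := xmat (tensor_hom A B R p) in
  kernel_norm X = norm X ^+ m /\ forall i j, shift X i (rshift 1 j) = 0.
Proof.
case: p => x y X.
have XE : X = S (coords phiB (uval y)) *m delta_mx 0 0 *m P (coords phiA (uval x)).
  have h1 : uval (tensor_hom A B R (x, y)) = tensor_ext (uval x) (uval y) by [].
  have := xmat_mul_ext (1%g : gpts G R) h1; rewrite mul1g xmat1 //.
have pp' := regmx_inverse (uvalV x).
have NX : norm X = \det (S (coords phiB (uval y))) ^+ a
    * \det (P (coords phiA (uval x))) ^+ b.
  by rewrite /X /xmat [uval _]/= (tnorm_ext phiAK psiAK phiBK psiBK) det_tr.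
split=> [|i j].
  rewrite NX -(det_scale_regmx rhoB e _ pp').
  have := regmx_kernel_head_act e rhoAP rhoBP (coords phiB (uval y)) (coords phiA (uval x))
            (delta_mx 0 0).
  rewrite -XE kernel_head1 regmx1 // => /(congr1 (fun M => \det (M *m P (coords phiA (uinv x))))).
  rewrite -mulmxA pp' mulmx1 -scalemxAl mul1mx detZ.
  by [].
rewrite XE shift_act // /shift kernel_head1 regmx1 // mulmx1 -scalemxAl !mxE.
by rewrite big1 ?mulr0 // => l _; rewrite !mxE andbF mulr0.
Qed.

(** A point of the closed image satisfies the two equations of
[tensor_hom_equations].  By the first one the first entry of its kernel vector
is invertible, as the tensor is; by the second one the tensor is the product of
the inverse of that entry and an element of B.  Thus it is a pure tensor without
any extension of R. *)
Lemma image_tensorP (R : comAlgType k) (h : gpts G R) : H h ->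
  exists x y p', uval h = tensor_ext x y /\ P (coords phiA x) *m P p' = 1%:M.
Proof.
move=> Hh; set X := xmat h.
have NX : kernel_norm X = norm X ^+ m.
  apply/eqP; rewrite -subr_eq0; apply/eqP.
  apply: (Hh (RegFun image_norm_nat)) => T x /=.
  by rewrite (tensor_hom_equations x).1 subrr.
have shX i j : shift X i (rshift 1 j) = 0.
  by apply: (Hh (RegFun (image_shift_nat i j))) => T x; exact: (tensor_hom_equations x).2.
pose t := norm_inv h ^+ m.
have ct : \det (P (kernel_head X)) * t = 1.
  by rewrite -/(kernel_norm X) NX /t -exprMn unit_norm_invP ?expr1n.
pose p : 'rV[R]_a := t *: (delta_mx 0 0 *m \adj (P (kernel_head X))).
have Pp : P p *m P (kernel_head X) = 1%:M.
  by rewrite regmxZ -(regmx_adj rhoAP ct) -scalemxAl mul_adj_mx scale_scalar_mx mulrC ct.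
have XE : X = (shift_head X)^T *m p.
  have -> : p = delta_mx 0 0 *m P p by rewrite mul1_regmx.
  rewrite mulmxA -[LHS]mulmx1 -Pp regmx_comm // mulmxA -/(shift X); congr (_ *m _).
  apply/matrixP=> i j; rewrite [RHS]mxE big_ord1.
  case: (splitP (j : 'I_(1 + (m + c)))) => l jl.
    rewrite (_ : j = 0); last by apply: val_inj; rewrite /= jl ord1.
    by rewrite !mxE !eqxx mulr1.
  rewrite (_ : j = rshift 1 l); last exact: val_inj.
  by rewrite shX [X in _ * X]mxE andbF mulr0.
exists (of_coords psiA p), (of_coords psiB (shift_head X)), (kernel_head X).
rewrite (of_coordsK psiAK); split=> //.
apply: (can_inj (tcoordsK phiAK phiBK (R := R))).
by rewrite tcoords_ext (of_coordsK psiAK) (of_coordsK psiBK) -XE.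
Qed.

Section InvariantMatrices.
Variable R : comAlgType k.

(** The powers of the norm by which pure tensors act on [kernel_coords] and
[shift_coords] are the m-th and the n-th. *)
Definition inv_kernel_coords (w : G R) : 'M[R]_(n, a) := norm_inv w ^+ m *: kernel_coords (xmat w).
Definition inv_shift_coords (w : G R) : 'M[R]_(b, a) := norm_inv w ^+ n *: shift_coords (xmat w).

Lemma norm_inv_mul (w h : gpts G R) x y : uval h = tensor_ext x y ->
  norm_inv (w * h)%g * (\det (S (coords phiB y)) ^+ a * \det (P (coords phiA x)) ^+ b) =
  norm_inv w.
Proof.
move=> hxy; rewrite -[\det (S _)]det_tr trmxK -(tnorm_ext phiAK psiAK phiBK psiBK) -hxy.
rewrite /norm_inv -[uinv (w * h)%g]/(uinv h * uinv w) (tnormM phiAK psiAK phiBK psiBK).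
rewrite mulrAC [norm _ * norm (tcoords _ _ (uval h))]mulrC.
by rewrite (unit_norm_invP phiAK psiAK phiBK psiBK h) mul1r.
Qed.

Lemma inv_kernel_coords_act (w h : gpts G R) : H h -> inv_kernel_coords (w * h)%g = inv_kernel_coords w.
Proof.
case/image_tensorP=> x [y] [p'] [hxy pp']; rewrite /inv_kernel_coords (xmat_mul_ext w hxy).
by rewrite (kernel_coords_act _ _ _ _ _ pp') // scalerA -exprMn (norm_inv_mul w hxy).
Qed.

Lemma inv_shift_coords_act (w h : gpts G R) : H h -> inv_shift_coords (w * h)%g = inv_shift_coords w.
Proof.
case/image_tensorP=> x [y] [p'] [hxy pp']; rewrite /inv_shift_coords (xmat_mul_ext w hxy).
by rewrite shift_coords_act // scalerA -exprMn (norm_inv_mul w hxy).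
Qed.

End InvariantMatrices.

Lemma inv_kernel_coords_map (R R' : comAlgType k) (f : {lrmorphism R -> R'}) (w : G R) :
  inv_kernel_coords (fmap G f w) = map_mx f (inv_kernel_coords w).
Proof. by rewrite /inv_kernel_coords unit_norm_inv_map xmat_map -map_kernel_coords map_mxZ rmorphXn. Qed.

Lemma inv_shift_coords_map (R R' : comAlgType k) (f : {lrmorphism R -> R'}) (w : G R) :
  inv_shift_coords (fmap G f w) = map_mx f (inv_shift_coords w).
Proof. by rewrite /inv_shift_coords unit_norm_inv_map xmat_map -map_shift_coords map_mxZ rmorphXn. Qed.

(** All invariant functions that are needed are functions of the entries of the
two invariant matrices. *)
Section InvariantFunction.
Variable psi : forall R : comAlgType k, 'M[R]_(n, a) -> 'M[R]_(b, a) -> R.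
Hypothesis psi_map : forall (R R' : comAlgType k) (f : {lrmorphism R -> R'}) u v,
  psi (map_mx f u) (map_mx f v) = f (psi u v).

Fact inv_of_nat (R R' : comAlgType k) (f : {lrmorphism R -> R'}) (w : G R) :
  psi (inv_kernel_coords (fmap G f w)) (inv_shift_coords (fmap G f w)) =
  f (psi (inv_kernel_coords w) (inv_shift_coords w)).
Proof. by rewrite inv_kernel_coords_map inv_shift_coords_map psi_map. Qed.

Fact inv_of_act (R : comAlgType k) (w h : gpts G R) : H h ->
  psi (inv_kernel_coords (w * h)%g) (inv_shift_coords (w * h)%g) =
  psi (inv_kernel_coords w) (inv_shift_coords w).
Proof. by move=> Hh; rewrite (inv_kernel_coords_act w Hh) (inv_shift_coords_act w Hh). Qed.

Definition inv_of : invfun (G := G) H :=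
  @InvFun k G H (RegFun inv_of_nat) inv_of_act.

End InvariantFunction.

Local Notation N := (n' * a + b * c)%N.

Section SliceCoordinates.
Variable R : comAlgType k.
Implicit Types (y : 'rV[R]_N) (u : 'M[R]_(n, a)) (z : 'M[R]_(b, c)).

(** The coordinates of affine space are the rows of u after the first, which is
(1, 0, ..., 0), and the entries of z. *)
Definition dec_u y : 'M[R]_(n, a) := col_mx (delta_mx 0 0) (vec_mx (lsubmx y)).
Definition dec_z y : 'M[R]_(b, c) := vec_mx (rsubmx y).
Definition enc u z : 'rV[R]_N := row_mx (mxvec (dsubmx u)) (mxvec z).

Lemma enc_dec y : enc (dec_u y) (dec_z y) = y.
Proof. by rewrite /enc col_mxKd !vec_mxK hsubmxK. Qed.

Lemma row0_dec_u y : row 0 (dec_u y) = delta_mx 0 0.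
Proof.
apply/rowP=> j; rewrite mxE; transitivity (dec_u y (lshift n' 0) j).
  by congr (dec_u y _ j); apply: val_inj.
by rewrite col_mxEu.
Qed.

Lemma dec_u_enc u z : row 0 u = delta_mx 0 0 -> dec_u (enc u z) = u.
Proof.
move=> u1; rewrite /dec_u row_mxKl mxvecK -[RHS]vsubmxK; congr col_mx.
rewrite -u1; apply/matrixP=> i j; rewrite !mxE ord1; congr (u _ j).
exact: val_inj.
Qed.

Lemma dec_z_enc u z : dec_z (enc u z) = z.
Proof. by rewrite /dec_z row_mxKr mxvecK. Qed.

Lemma encZ t u z : enc (t *: u) (t *: z) = t *: enc u z.
Proof. by rewrite /enc !linearZ /= scale_row_mx. Qed.

Definition slice_mx y := slice (dec_u y) (dec_z y).
Definition slice_Delta y := kernel_vector (slice_mx y) 0 0.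
Definition slice_D y := \det (sysmx (dec_u y)).
(** Invertible where the slice consists of units, the kernel is a line, and the
linear system is regular. *)
Definition slice_det y : R := norm (slice_mx y) * (slice_Delta y * slice_D y).

End SliceCoordinates.

Section SliceCoordinatesNaturality.
Variables (R R' : comAlgType k) (f : {lrmorphism R -> R'}).
Local Notation "M ^f" := (map_mx f M).

Lemma map_dec_u y : (dec_u y)^f = dec_u (y^f).
Proof. by rewrite /dec_u map_col_mx map_delta_mx map_vec_mx map_lsubmx. Qed.

Lemma map_dec_z y : (dec_z y)^f = dec_z (y^f).
Proof. by rewrite /dec_z map_vec_mx map_rsubmx. Qed.

Lemma map_enc u z : (enc u z)^f = enc (u^f) (z^f).
Proof. by rewrite /enc map_row_mx !map_mxvec map_dsubmx. Qed.

Lemma map_slice_mx y : (slice_mx y)^f = slice_mx (y^f).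
Proof. by rewrite /slice_mx map_slice map_dec_u map_dec_z. Qed.

Lemma slice_det_nat y : slice_det (fmap (affine_space k N) f y) = f (slice_det y).
Proof.
rewrite /slice_det /slice_Delta /slice_D /= -map_slice_mx -tnorm_map -map_kernel_vector.
by rewrite -map_dec_u -map_sysmx det_map_mx !rmorphM [_^f _ _]mxE.
Qed.

End SliceCoordinatesNaturality.

Definition slice_fun : regfun (affine_space k N) := RegFun slice_det_nat.

Section SlicePoint.
Variables (R : comAlgType k) (y : principal_open slice_fun R).

Fact slice_norm_unit :
  norm (slice_mx (sval y).1) * (slice_Delta (sval y).1 * slice_D (sval y).1 * (sval y).2) = 1.
Proof. by rewrite mulrA; exact: (eqP (svalP y)). Qed.

Definition slice_point : G R :=
  sval (ex_unit_of_norm phiAK psiAK phiBK psiBK mulAC mulBC slice_norm_unit).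

Lemma xmat_slice_point : xmat slice_point = slice_mx (sval y).1.
Proof. exact: svalP (ex_unit_of_norm phiAK psiAK phiBK psiBK mulAC mulBC slice_norm_unit). Qed.

End SlicePoint.

Fact slice_point_nat (R R' : comAlgType k) (f : {lrmorphism R -> R'})
    (y : principal_open slice_fun R) :
  slice_point (fmap (principal_open slice_fun) f y) = fmap G f (slice_point y).
Proof.
apply: (xmat_inj phiAK phiBK); rewrite xmat_map !xmat_slice_point map_slice_mx.
by [].
Qed.

Definition slice_map : kmap (principal_open slice_fun) G := KMap slice_point_nat.

Lemma sysmxZ (R : comAlgType k) (t : R) u : sysmx (t *: u) = t *: sysmx u.
Proof.
apply/row_matrixP=> i; rewrite !rowE -scalemxAr -[delta_mx 0 i]vec_mxK.
rewrite -[sysmx _]/(lin_mx (pairing_mid rhoA rhoB e (t *: u))).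
rewrite -[sysmx u]/(lin_mx (pairing_mid rhoA rhoB e u)) !mul_vec_lin /=.
by rewrite /pairing_mid !linearZ.
Qed.

(** The common denominator of the coordinates: u and v have to be divided by
their entries u_00 and v_00 to be normalized, and the determinant of the system
has to be invertible for the result to lie in the orbit of the slice. *)
Definition den_fun (R : comAlgType k) (u : 'M[R]_(n, a)) (v : 'M[R]_(b, a)) : R :=
  u 0 0 * v 0 0 * \det (sysmx u).

(** The normalized coordinates multiplied by [den_fun]. *)
Definition num_mx (R : comAlgType k) (u : 'M[R]_(n, a)) (v : 'M[R]_(b, a)) : 'rV[R]_N :=
  enc ((v 0 0 * \det (sysmx u)) *: u)
      ((u 0 0 * \det (sysmx u)) *: rsubmx (rsubmx (v : 'M_(b, 1 + (m + c))))).

(** Divided by a power of [den_fun], the inverse of the determinant of the slice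
at the normalized coordinates, expressed by the entries of the two invariant
matrices ([slice_det_generic]). *)
Definition den_inv_fun (R : comAlgType k) (u : 'M[R]_(n, a)) (v : 'M[R]_(b, a)) : R :=
  v 0 0 ^+ (a + m) * (u 0 0 ^+ (b * m) * (u 0 0 * v 0 0)) ^+ (b * (a + m)).+1
  * (v 0 0 * \det (sysmx u)) ^+ (b + n).

Section FunctionsNaturality.
Variables (R R' : comAlgType k) (f : {lrmorphism R -> R'}).

Fact den_fun_map u v : den_fun (map_mx f u) (map_mx f v) = f (den_fun u v).
Proof. by rewrite /den_fun -map_sysmx det_map_mx !mxE !rmorphM. Qed.

Fact num_mx_map u v : num_mx (map_mx f u) (map_mx f v) = map_mx f (num_mx u v).
Proof.
rewrite /num_mx map_enc !map_mxZ !rmorphM -map_sysmx det_map_mx !map_rsubmx.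
by rewrite ![map_mx f _ 0 0]mxE.
Qed.

Fact den_inv_fun_map u v :
  den_inv_fun (map_mx f u) (map_mx f v) = f (den_inv_fun u v).
Proof. by rewrite /den_inv_fun -map_sysmx det_map_mx !mxE 2!rmorphM 3!rmorphXn 3!rmorphM rmorphXn. Qed.

End FunctionsNaturality.

Definition den : invfun (G := G) H := inv_of den_fun_map.
Definition den_inv : invfun (G := G) H := inv_of den_inv_fun_map.
Fact num_map i (R R' : comAlgType k) (f : {lrmorphism R -> R'}) u v :
  num_mx (map_mx f u) (map_mx f v) 0 i = f (num_mx u v 0 i).
Proof. by rewrite num_mx_map mxE. Qed.
Definition num i : invfun (G := G) H := inv_of (num_map i).

Definition invertible (R : comNzRingType) (x : R) := exists y, x * y = 1.

Lemma invertibleM (R : comNzRingType) (x y : R) :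
  invertible x -> invertible y -> invertible (x * y).
Proof. by move=> [x' xx'] [y' yy']; exists (x' * y'); rewrite mulrACA xx' yy' mulr1. Qed.

Lemma invertibleX (R : comNzRingType) (x : R) i : invertible x -> invertible (x ^+ i).
Proof. by move=> [x' xx']; exists (x' ^+ i); rewrite -exprMn xx' expr1n. Qed.

Section OnSlice.
Variables (R : comAlgType k) (y : principal_open slice_fun R).
Let w := slice_point y.
Let u := dec_u (sval y).1.
Let z := dec_z (sval y).1.
Let Delta := slice_Delta (sval y).1.
Let D := slice_D (sval y).1.

Lemma inv_kernel_coords_slice :
  inv_kernel_coords w = (norm_inv w ^+ m * Delta ^+ a) *: u.
Proof.
by rewrite /inv_kernel_coords xmat_slice_point kernel_coords_slice ?row0_dec_u // scalerA.
Qed.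

Lemma inv_shift_coords_slice :
  inv_shift_coords w = (norm_inv w ^+ n * ((Delta * D) ^+ b' * Delta)) *: slice u z.
Proof.
by rewrite /inv_shift_coords xmat_slice_point shift_coords_slice ?row0_dec_u // scalerA.
Qed.

Lemma slice00 : slice u z 0 0 = D.
Proof.
have /colP/(_ 0) := col0_slice rhoA rhoB e u z.
by rewrite !mxE mulr1.
Qed.

Lemma rsub_slice : rsubmx (rsubmx (slice u z)) = D *: z.
Proof. by rewrite /slice !row_mxKr. Qed.

Lemma u00 : u 0 0 = 1.
Proof. by have /rowP/(_ 0) := row0_dec_u (sval y).1; rewrite !mxE. Qed.

Lemma scalemx00 p q t (M : 'M[R]_(1 + p, 1 + q)) : (t *: M) 0 0 = t * M 0 0.
Proof. by rewrite mxE. Qed.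

Lemma num_slice i : num i R w = den R w * (sval y).1 0 i.
Proof.
rewrite /= /num_mx /den_fun inv_kernel_coords_slice inv_shift_coords_slice.
set nu := _ * Delta ^+ a; set nu' := _ * (_ * Delta).
rewrite !scalemx00 u00 mulr1 slice00 [rsubmx (nu' *: _)]linearZ /= [rsubmx (nu' *: _)]linearZ /= rsub_slice.
rewrite !scalerA -[in RHS](enc_dec (sval y).1) -/u -/z.
set d := \det _.
have -> : nu' * D * d * nu = nu * (nu' * D) * d by ring.
have -> : nu * d * nu' * D = nu * (nu' * D) * d by ring.
by rewrite (encZ _ u z) mxE.
Qed.

Lemma den_slice : exists t, den R w * t = 1.
Proof.
rewrite /= /den_fun inv_kernel_coords_slice inv_shift_coords_slice sysmxZ detZ.
rewrite !scalemx00 u00 mulr1 slice00.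
have gy : slice_det (sval y).1 * (sval y).2 = 1 by exact: (eqP (svalP y)).
have iD : invertible Delta.
  exists (norm (slice_mx (sval y).1) * (D * (sval y).2)).
  by apply: etrans gy; rewrite /slice_det -/Delta -/D; ring.
have iD' : invertible D.
  exists (norm (slice_mx (sval y).1) * (Delta * (sval y).2)).
  by apply: etrans gy; rewrite /slice_det -/Delta -/D; ring.
have it : invertible (norm_inv w).
  by exists (norm (xmat w)); rewrite mulrC unit_norm_invP.
by repeat first [assumption | apply: invertibleM | apply: invertibleX].
Qed.

End OnSlice.

Lemma norm_act (R : comAlgType k) (s : 'rV[R]_b) (X : 'M[R]_(b, a)) (p : 'rV[R]_a) :
  norm (S s *m X *m P p) = norm X * (\det (S s) ^+ a * \det (P p) ^+ b).
Proof.
pose w := of_tcoords psiA psiB X.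
have wX : tcoords phiA phiB w = X by exact: of_tcoordsK.
rewrite -wX -{1}(of_coordsK psiBK s) -{1}(of_coordsK psiAK p) /actB.
rewrite -tcoords_mul_ext // (tnormM phiAK psiAK phiBK psiBK); congr (_ * _).
by rewrite (tnorm_ext phiAK psiAK phiBK psiBK) !of_coordsK // det_tr.
Qed.

(** For w at which the denominator is invertible.  With p and s as below,
[slice_coords_orbit] moves w to the slice by the pure tensor of p and s; iA, iB
and iD invert the three factors of the denominator. *)
Section ToSlice.
Variables (R : comAlgType k) (w : gpts G R) (phi : R).
Hypothesis den_phi : den R w * phi = 1.
Let X := xmat w.
Let nuA := inv_kernel_coords w 0 0.
Let nuB := inv_shift_coords w 0 0.
Let delta := \det (sysmx (inv_kernel_coords w)).
Let t := norm_inv w.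
Let iA := nuB * delta * phi.
Let iB := nuA * delta * phi.
Let iD := nuA * nuB * phi.

Let nuA_iA : nuA * iA = 1.
Proof. by rewrite -den_phi /= /den_fun -/nuA -/nuB -/delta /iA !mulrA. Qed.
Let nuB_iB : nuB * iB = 1.
Proof. by rewrite -den_phi /= /den_fun -/nuA -/nuB -/delta /iB !mulrA [nuB * _]mulrC. Qed.
Let delta_iD : delta * iD = 1.
Proof. by rewrite -den_phi /= /den_fun -/nuA -/nuB -/delta /iD mulrA [delta * _]mulrC. Qed.
Let Nt : norm X * t = 1.
Proof. exact: (unit_norm_invP phiAK psiAK phiBK psiBK w). Qed.

Let nuAE : nuA = t ^+ m * kernel_norm X.
Proof. by rewrite /nuA /inv_kernel_coords scalemx00 kernel_coords00. Qed.
Let nuBE : nuB = t ^+ n * shift_norm X.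
Proof. by rewrite /nuB /inv_shift_coords scalemx00 shift_coords00. Qed.

Let na := t ^+ m * iA.
Let nb := t ^+ n * iB.
Let nA : kernel_norm X * na = 1.
Proof. by rewrite /na mulrA [kernel_norm X * _]mulrC -nuAE. Qed.
Let nB : shift_norm X * nb = 1.
Proof. by rewrite /nb mulrA [shift_norm X * _]mulrC -nuBE. Qed.

Let u := na *: kernel_coords X.
Let z := nb *: rsubmx (rsubmx (shift_coords X : 'M_(b, 1 + (m + c)))).
Definition generic_coords : 'rV[R]_N := enc u z.
Let D := \det (sysmx u).
Let p := kernel_head X.
Let s : 'rV[R]_b := (D * nb) *: (\adj (S (shift_head X)) *m delta_mx 0 0)^T.
Let detP := \det (P p).
Let detS := \det (S s).

Let u1 : row 0 u = delta_mx 0 0.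
Proof. exact: row0_coords. Qed.

Let uE : inv_kernel_coords w = nuA *: u.
Proof.
by rewrite /u /na scalerA mulrCA nuA_iA mulr1.
Qed.

Lemma num_generic_coords i : num i R w = den R w * generic_coords 0 i.
Proof.
transitivity ((den R w *: generic_coords) 0 i); last by rewrite mxE.
rewrite /generic_coords -(encZ _ u z).
have -> : den R w *: u = (nuB * delta) *: inv_kernel_coords w.
  by rewrite uE scalerA; congr (_ *: _); rewrite /= /den_fun -/nuA -/nuB -/delta; ring.
suff -> : den R w *: z = (nuA * delta) *: rsubmx (rsubmx (inv_shift_coords w : 'M_(b, 1 + (m + c)))).
  by [].
rewrite /inv_shift_coords [rsubmx (_ *: _)]linearZ /= [rsubmx (_ *: _)]linearZ /= /z !scalerA.
congr (_ *: _); rewrite /den_fun -/nuA -/nuB -/delta /nb -/t.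
by rewrite -[RHS]mulr1 -nuB_iB; ring.
Qed.

Lemma slice_generic_coords : slice_mx generic_coords = S s *m X *m P p.
Proof.
rewrite /slice_mx /generic_coords dec_u_enc // dec_z_enc.
exact: (slice_coords_orbit rhoAP rhoBP na nB).
Qed.

Let delta_D : delta = nuA ^+ (b * m) * D.
Proof. by rewrite /delta uE sysmxZ detZ. Qed.

Let Dinv := nuA ^+ (b * m) * iD.
Let D_Dinv : D * Dinv = 1.
Proof. by rewrite /Dinv mulrA [D * _]mulrC -delta_D delta_iD. Qed.

Let detPE : detP = nuA * norm X ^+ m.
Proof. by rewrite nuAE mulrAC -exprMn [t * _]mulrC Nt expr1n mul1r. Qed.

Let detSE : detS = D ^+ b * (t ^+ n * iB).
Proof.
have : S s *m S (shift_head X) = D%:M.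
  rewrite /s linearZ /= -(actB_adj rhoBP nB) -scalemxAl mul_adj_mx.
  by rewrite scale_scalar_mx -mulrA [nb * _]mulrC nB mulr1.
move/(congr1 determinant); rewrite det_mulmx det_scalar -/detS => E.
by rewrite -E -/nb -mulrA nB mulr1.
Qed.

Let DeltaE : slice_Delta generic_coords = detS ^+ m * detP ^+ n.
Proof.
have := regmx_kernel_head_act e rhoAP rhoBP s p X.
rewrite -slice_generic_coords /slice_mx kernel_head_slice ?row0_dec_u // -/(slice_mx _).
rewrite regmxZ regmx1 // -scalemxAl mul1mx -/(slice_Delta _).
have PP : P p *m (na *: \adj (P p)) = 1%:M.
  by rewrite -scalemxAr mul_mx_adj scale_scalar_mx mulrC nA.
move/(congr1 (mulmx^~ (na *: \adj (P p)))); rewrite -!scalemxAl PP.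
by move/matrixP/(_ 0 0); rewrite !mxE !eqxx !mulr1.
Qed.

(** All factors of the determinant are powers of the norms of w, p and s and of
the determinant D of the system. *)
Lemma slice_det_generic : slice_det generic_coords *
  (den_inv R w * phi ^+ ((b * (a + m)).+1 + (b + n))) = 1.
Proof.
rewrite /slice_det slice_generic_coords norm_act DeltaE.
have -> : slice_D generic_coords = D by rewrite /slice_D dec_u_enc.
rewrite -/detS -/detP.
have -> : den_inv R w * phi ^+ ((b * (a + m)).+1 + (b + n)) =
    nuB ^+ (a + m) * Dinv ^+ (b * (a + m)).+1 * iA ^+ (b + n).
  rewrite -[den_inv R w]/(den_inv_fun (inv_kernel_coords w) (inv_shift_coords w)) /den_inv_fun.
  rewrite -/nuA -/nuB -/delta /Dinv /iD /iA.
  set M := (b * (a + m)).+1; set L := (b + n)%N; set K := (a + m)%N; set J := (b * m)%N.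
  rewrite [phi ^+ _]exprD mulrACA -(exprMn L (nuB * delta) phi).
  by rewrite -[_ * _ ^+ M * phi ^+ M]mulrA -exprMn !mulrA.
rewrite detSE detPE; apply: weights_cancel => //.
by rewrite mulnDr e mulnDr [(n * m)%N]mulnC addnA [(b * m)%N]mulnC.
Qed.

(** The elements p and s are units since their norms are, so that the pure tensor
is a point of the image of j. *)
Lemma generic_orbit (h : invfun (G := G) H) (y : principal_open slice_fun R) :
  (sval y).1 = generic_coords -> h R (slice_point y) = h R w.
Proof.
move=> yE.
have [x xp] : {x | coords phiA x = p} by exists (of_coords psiA p); rewrite of_coordsK.
have [v vs] : {v | coords phiB v = s} by exists (of_coords psiB s); rewrite of_coordsK.
have [x' x'x] : {x' | x' * x = 1}.
  by apply: (det_inverse phiAK psiAK (t := na)); rewrite xp.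
have xx' : x * x' = 1.
  by rewrite (tensor_mulC mulAC) // => ? ?; exact: mulrC.
have [v' v'v] : {v' | v' * v = 1}.
  apply: (det_inverse phiBK psiBK (t := shift_norm X * Dinv ^+ b)).
  rewrite vs -det_tr -/(S s) -/detS detSE -/nb -mulrA [nb * _]mulrA [nb * shift_norm X]mulrC.
  by rewrite nB mul1r -exprMn D_Dinv expr1n.
have vv' : v * v' = 1.
  by rewrite (tensor_mulC mulBC) // => ? ?; exact: mulrC.
pose q : kprod (GL1 A) (GL1 B) R := (unit_of xx' x'x, unit_of vv' v'v).
have Hq : H (tensor_hom A B R q) by move=> f fq; exact: fq.
rewrite -(invP h w Hq); congr (h R _); apply: (xmat_inj phiAK phiBK).
rewrite xmat_slice_point yE slice_generic_coords.
by rewrite (@xmat_mul_ext _ w (tensor_hom A B R q) x v) // xp vs.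
Qed.

End ToSlice.

(** The tensor 1 is its own normalization. *)
Lemma den1 (R : comAlgType k) : den R 1%g = 1.
Proof.
have t1 : norm_inv (1%g : gpts G R) = 1.
  have := unit_norm_invP phiAK psiAK phiBK psiBK (1%g : gpts G R).
  by rewrite xmat1 norm_delta mul1r.
have cA : kernel_coords (delta_mx 0 0) = delta_mx 0 0 :> 'M[R]_(n, a).
  by rewrite /kernel_coords kernel_head1 regmx1 // adj1 mulmx1 kernel_vector1.
have cB : shift_coords (delta_mx 0 0) = delta_mx 0 0 :> 'M[R]_(b, a).
  rewrite /shift_coords /shift_head /shift kernel_head1 regmx1 // mulmx1.
  rewrite (_ : (col 0 _)^T = delta_mx 0 0) ?actB1 ?adj1 ?mul1mx //.
  by apply/rowP=> j; rewrite !mxE eqxx andbT.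
rewrite /= /den_fun /inv_kernel_coords /inv_shift_coords t1 !expr1n !scale1r xmat1 cA cB.
by rewrite sysmx1 // det1 !mxE !eqxx !mulr1.
Qed.

(** The origin of affine space is the point u = (1, 0, ..., 0), z = 0, at which
the slice passes through 1. *)
Lemma slice_det0 (R : comAlgType k) : slice_det (0 : 'rV[R]_N) = 1.
Proof.
have u0 : dec_u (0 : 'rV[R]_N) = delta_mx 0 0.
  apply/matrixP=> i j; rewrite /dec_u -[i]splitK; case: (split i) => l /=.
    by rewrite col_mxEu !mxE ord1.
  by rewrite col_mxEd linear0 linear0 !mxE.
have z0 : dec_z (0 : 'rV[R]_N) = 0 by rewrite /dec_z !linear0.
rewrite /slice_det /slice_Delta /slice_D /slice_mx u0 z0 slice1 // sysmx1 // det1.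
by rewrite kernel_vector1 // norm_delta !mxE !eqxx !mulr1.
Qed.

Theorem tensor_quotient_birational : birational (Q A B) (affine_space k N).
Proof.
pose w := generic_unit phiAK psiAK phiBK psiBK mulAC mulBC.
have gen (u : regfun G) : u _ w = 0 ->
  forall (R : comAlgType k) (x : G R), u R x = 0 by exact: generic_unitP.
have den0 : den _ w != 0.
  apply/eqP=> /(gen den)/(_ (ratfun k (b * a)) 1%g).
  by rewrite den1 => /eqP; rewrite oner_eq0.
have den_phi : den _ w * (den _ w)^-1 = 1 by rewrite divff.
apply: (@birational_of_slice k G H _ w gen N slice_fun slice_map den _ num
         (generic_coords w (den _ w)^-1) _ den_phi).
(* ratfun k 0 serves as the field k, regarded as an algebra over k *)
- apply: (@affine_space_nzd _ _ _ (ratfun k 0) 0).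
  by rewrite /= slice_det0 oner_neq0.
- by move=> R y; exact: den_slice.
- by move=> R y i; exact: num_slice.
- by move=> i; exact: num_generic_coords.
- exists den_inv, ((b * (a + m)).+1 + (b + n))%N.
  exact: slice_det_generic.
by move=> y yE u; exact: (generic_orbit den_phi).
Qed.

End TensorQuotient.

(** * Coprime dimensions *)

(** An etale algebra embeds into a product of fields. *)
Lemma etale_mulC (k : fieldType) (A : falgType k) : etale A ->
  forall x y : A, x * y = y * x.
Proof.
case=> r [K [phi [_ phi_inj _]]] x y; apply: phi_inj => i.
by rewrite !rmorphM mulrC.
Qed.

(** A Bezout relation u a = 1 + v b, in which v is reduced modulo a to get
m < a, that is a = 1 + (m + c). *)
Lemma coprime_bezout a b : (0 < a)%N -> (0 < b)%N -> coprime a b ->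
  exists n' m c, a = (1 + (m + c))%N /\ ((1 + n') * a = 1 + b * m)%N.
Proof.
move=> a0 b0 /(coprimeP b a0)[[u v] /= uv].
have vlt : (v %% a < a)%N by rewrite ltn_mod.
(* subtract b (v / a) times a from both sides *)
have E : ((u - b * (v %/ a)) * a = 1 + b * (v %% a))%N.
  have {uv} uv : (u * a = 1 + v * b)%N.
    by rewrite -[1%N in RHS]uv subnK // ltnW // -subn_gt0 uv.
  rewrite mulnBl uv {1}(divn_eq v a) mulnDl -mulnA [(a * b)%N]mulnC.
  by rewrite mulnA [(_ %/ a * b)%N]mulnC addnCA addnC addnK mulnC addnC [(b * _)%N]mulnC.
case En : (u - b * (v %/ a))%N E => [//|n'] E.
exists n', (v %% a)%N, (a - (v %% a).+1)%N; split; last by rewrite add1n.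
by rewrite addnA add1n subnKC.
Qed.

Theorem theorem2p1 (k : fieldType)
    (k_infinite : forall s : seq k, exists x : k, x \notin s)
    (A B : falgType k) (A_etale : etale A) (B_etale : etale B)
    (dim_coprime : coprime (\dim {: A}) (\dim {: B})) :
  k_rational (Q A B).
Proof.
have dim_gt0 (D : falgType k) : (0 < \dim {: D})%N by exact: adim_gt0.
have [n' [m [c [dA e]]]] := coprime_bezout (dim_gt0 A) (dim_gt0 B) dim_coprime.
have [b' dB] : exists b', \dim {: B} = (1 + b')%N.
  by exists (\dim {: B}).-1; rewrite add1n prednK.
have [phiA [psiA [phiAK psiAK phiA1]]] := unit_coordinates dA.
have [phiB [psiB [phiBK psiBK phiB1]]] := unit_coordinates dB.
rewrite dA dB in e.
exists (n' * (1 + (m + c)) + (1 + b') * c)%N.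
exact: (tensor_quotient_birational e (etale_mulC A_etale) (etale_mulC B_etale)
  phiAK psiAK phiBK psiBK phiA1 phiB1).
Qed.
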